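(* Let $(\mathcal{X},d)$ be a Polish metric space, let $\Phi$ be a set of bounded measurable functions on $\mathcal{X}$ which is symmetric ($\varphi\in\Phi\Rightarrow-\varphi\in\Phi$), let $\alpha\in\mathcal{C}$ satisfy assumptions $(A_1)$ and $(A_2)$, and let $\mu\in\mathcal{P}(\mathcal{X})$. The following statements are equivalent: (1) There exists $a>0$ such that for all $\nu\in\mathcal{P}(\mathcal{X})$, $\alpha\left(\frac{\|\nu-\mu\|^*_\Phi}{a}\right)\le \operatorname{H}(\nu\mid\mu)$. (2) There exists $M>0$ such that for all $\varphi\in\Phi$, $\|\varphi-\langle\varphi,\mu\rangle\|_{\tau_\alpha}\le M$. More precisely, if (1) holds true with constant $a$, then one can take $M=3a$ in (2). Conversely, if (2) holds true with constant $M$, then one can take $a=\sqrt{2}\,m_\alpha M$ in (1), where $$m_\alpha=e\max\left(\frac{1}{\alpha^{-1}(2)\sqrt{c_{\alpha^\circledast}(1-u)}},\frac1u\right),$$ with $u\in(0,1)$ such that $\frac{u}{\sqrt{1-u}}\le s_{\alpha^\circledast}\sqrt{c_{\alpha^\circledast}}$ and $\frac{u^3}{1-u}\le 2$, the constants $s_{\alpha^\circledast},c_{\alpha^\circledast}$ being those of assumption $(A_2)$.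
   Context: $\mathcal{P}(\mathcal{X})$ is the set of Borel probability measures on $\mathcal{X}$, and $\langle\varphi,\mu\rangle=\int_{\mathcal X}\varphi\,d\mu$. $\|\nu-\mu\|^*_\Phi:=\sup_{\varphi\in\Phi}\left\{\int_{\mathcal X}\varphi\,d\nu-\int_{\mathcal X}\varphi\,d\mu\right\}$. $\operatorname{H}(\nu\mid\mu)=\int_{\mathcal X}\log\frac{d\nu}{d\mu}\,d\nu$ if $\nu\ll\mu$, and $+\infty$ otherwise. $\mathcal{C}$ is the set of convex lower semicontinuous functions $\alpha:\mathbb{R}^+\to\mathbb{R}^+\cup\{+\infty\}$ with $\alpha(0)=0$; by convention $\alpha(+\infty)=\lim_{t\to+\infty}\alpha(t)$. The monotone conjugate of $\alpha$ is $\alpha^\circledast(s)=\sup_{t\ge0}\{st-\alpha(t)\}$, $s\ge0$. The inverse is $\alpha^{-1}(y)=\sup\{t\ge0:\alpha(t)\le y\}$. Assumption $(A_1)$: $\{s\in\mathbb{R}^+:\alpha^\circledast(s)<+\infty\}=[0,b)$ for some $b\in(0,+\infty]$. Assumption $(A_2)$: there exist $s_{\alpha^\circledast}>0$ and $c_{\alpha^\circledast}>0$ such that $\alpha^\circledast(s)\ge c_{\alpha^\circledast}s^2$ for all $s\in[0,s_{\alpha^\circledast}]$. $\tau_\alpha:=e^\alpha-1$; for measurable $f:\mathcal{X}\to\mathbb{R}$, $\|f\|_{\tau_\alpha}=\inf\{\lambda>0:\int_{\mathcal X}\tau_\alpha(|f|/\lambda)\,d\mu\le1\}$ (Luxemburg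 norm, $\inf\emptyset=+\infty$).
   Formalization: In the constant m_α, the inverse α^{-1}(2) is replaced by the inverse of the monotone conjugate, (α^⊛)^{-1}(2), since the last quantitative claim is false with α^{-1}(2). *)

(* Defs.v *)
From HB Require Import structures.
From mathcomp Require Import all_boot all_order all_algebra.
From mathcomp Require Import all_classical all_reals all_analysis.

Set Implicit Arguments.
Unset Strict Implicit.
Unset Printing Implicit Defensive.

Import Order.TTheory GRing.Theory Num.Theory.
Import numFieldNormedType.Exports.

Local Open Scope classical_set_scope.
Local Open Scope ring_scope.
Local Open Scope charge_scope.

(* Being a [Complete] space includes being pointed, hence nonempty; this loses
   nothing for spaces that carry a probability measure. *)
#[short(type="completeMetricType")]
HB.structure Definition CompleteMetric (R : numDomainType) :=
  {T of Metric R T & Complete T}.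

Definition separable (T : topologicalType) : Prop :=
  exists2 D : set T, countable D & dense D.

Notation borel X := (g_sigma_algebraType (@open X)).

Section MonotoneFunctions.
Context {R : realType}.
Implicit Types (alpha f : R -> \bar R) (x : \bar R) (s t y c : R).

(* A function R^+ -> R^+ U {+oo} is a function on R whose values at negative
   arguments are never used; lower semicontinuity is for the subspace topology
   of [0, +oo[. *)
Definition classC alpha : Prop :=
  [/\ forall t, 0 <= t -> (0 <= alpha t)%E,
      alpha 0 = 0%E,
      forall s t l : R, 0 <= s -> 0 <= t -> 0 <= l <= 1 ->
        (alpha (l * s + (1 - l) * t)%R
           <= l%:E * alpha s + (1 - l)%:E * alpha t)%E
    & @lower_semicontinuous (subspace [set t : R | 0 <= t]) R alpha].

(* Extension of alpha to [0, +oo]. The value at -oo is only used for the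
   supremum of an empty family, which is 0 when computed in [0, +oo]. *)
Definition extend alpha x : \bar R :=
  match x with
  | t%:E => alpha t
  | +oo%E => lim (alpha t @[t --> +oo])
  | -oo%E => 0%E
  end.

Definition mconj alpha s : \bar R :=
  ereal_sup [set ((s * t)%:E - alpha t)%E | t in [set t : R | 0 <= t]].

Definition minverse f y : \bar R :=
  ereal_sup [set t%:E | t in [set t : R | 0 <= t /\ (f t <= y%:E)%E]].

Definition assumptionA1 alpha : Prop :=
  exists2 b : \bar R, (0 < b)%E &
    [set s | 0 <= s /\ (mconj alpha s < +oo)%E] =
    [set s | 0 <= s /\ (s%:E < b)%E].

Definition assumptionA2 alpha s0 c : Prop :=
  [/\ 0 < s0, 0 < c &
      forall s, 0 <= s <= s0 -> ((c * s ^+ 2)%:E <= mconj alpha s)%E].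

Definition admissible s0 c (u : R) : Prop :=
  [/\ 0 < u < 1, u / Num.sqrt (1 - u) <= s0 * Num.sqrt c
    & u ^+ 3 / (1 - u) <= 2].

(* The inverse is that of the conjugate of alpha. Replacing alpha by
   t |-> alpha (k * t) divides c by k ^ 2 and multiplies s0 and this inverse
   by k, so the constant is unchanged, as it must be; this would fail with the
   inverse of alpha itself. Under A1 and A2 the inverse is finite and positive,
   so [fine] is harmless. *)
Definition malpha alpha c (u : R) : R :=
  expR 1 * Num.max
    (1 / (fine (minverse (mconj alpha) 2) * Num.sqrt (c * (1 - u)))) (1 / u).

Definition tau alpha t : \bar R := (expeR (alpha t) - 1)%E.

End MonotoneFunctions.

Section Measures.
Context {d : measure_display} {T : measurableType d} {R : realType}.
Implicit Types (mu nu : probability T R) (Phi : set (T -> R)).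

Definition dual_norm Phi nu mu : \bar R :=
  ereal_sup [set (\int[nu]_x phi x - \int[mu]_x phi x)%:E | phi in Phi].

Definition entropy nu mu : \bar R :=
  if `[< nu `<< mu >] then
    (\int[nu]_x lne (('d (charge_of_finite_measure nu) '/d mu) x))%E
  else +oo%E.

Definition luxemburg mu (alpha : R -> \bar R) (f : T -> R) : \bar R :=
  ereal_inf [set l%:E | l in [set l : R | 0 < l /\
    (\int[mu]_x tau alpha (`|f x| / l)%R <= 1)%E]].

Definition transport_inequality alpha Phi mu (a : R) : Prop :=
  forall nu, (extend alpha (dual_norm Phi nu mu / a%:E) <= entropy nu mu)%E.

Definition luxemburg_bound alpha Phi mu (M : R) : Prop :=
  forall phi, Phi phi ->
    (luxemburg mu alpha (fun x => phi x - \int[mu]_z phi z)%R <= M%:E)%E.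

End Measures.

(* Main.v *)
From HB Require Import structures.
Require Import Defs.
From mathcomp Require Import all_boot all_order all_algebra.
From mathcomp Require Import all_classical all_reals all_analysis.
From mathcomp Require Import measurable_realfun.
From mathcomp Require Import ring lra.
Import Order.TTheory GRing.Theory Num.Theory.
Import numFieldNormedType.Exports.
Local Open Scope classical_set_scope.
Local Open Scope ring_scope.

Local Open Scope charge_scope.

(** Write X = phi - <phi, mu> for phi in Phi, and g for the monotone conjugate
    of alpha. Both the transport inequality with constant a and the bound on
    the Luxemburg norms are compared with a third property, the Laplace bound

      log (int e^(s X) dmu) <= g (a s)   for all phi in Phi and s >= 0.

    The transport inequality with constant a is equivalent to the Laplace bound
    with constant a. This is the duality between relative entropy and
    exponential integrals: int psi dnu - log (int e^psi dmu) <= H(nu | mu), with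
    equality when nu is proportional to e^psi mu ([donsker_varadhan],
    [gibbs_attained]). Taking psi = s X and nu the tilted measure gives one
    implication ([transport_laplace]). For the other one, optimizing over s
    turns g back into alpha, because alpha is the supremum of its affine
    minorants ([affine_minorant], a one-dimensional Fenchel-Moreau theorem);
    lower semicontinuity of alpha then allows to take the supremum over phi
    ([laplace_transport]).

    The Laplace bound controls the Luxemburg norm. Chernoff's method gives
    mu (alpha (|X| / a) > y) <= 2 e^(-y) ([laplace_level]), and convexity gives
    alpha (t / 3) <= alpha t / 3, so that the variable
    Z = e^(alpha (|X| / (3 a))) - 1 satisfies mu (Z > z) <= 2 (1 + z)^(-3). The
    integral of this bound over z >= 0 is exactly 1 ([laplace_luxemburg]).

    Conversely, let W = X / l with int tau_alpha(|W|) dmu <= 1. Young's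
    inequality s |W| <= g s + alpha |W| gives int e^(s |W|) dmu <= 2 e^(g s)
    ([luxemburg_exp_moment]), which has to be improved to e^(g (k s)) with
    k = sqrt 2 * m_alpha. Let sigma be the value at 2 of the inverse of g, and
    y = e s / sigma. When y > u, the number g (k s) is at least 2 and at least
    twice g s, so that it absorbs the factor 2. When y <= u, a second order
    expansion of e^(s W), whose linear term vanishes because W is centered,
    gives 1 + 8 (y / (e - y))^2 ([centered_laplace]), and the quadratic lower
    bound on g near 0 makes g (k s) larger than 8 (y / (e - y))^2
    ([mconj_small], [taylor_term_le]). Both cases are put together in
    [laplace_normalized]. *)

(** * Cost functions and their monotone conjugates *)

Section CostFunctions.
Context {R : realType}.
Implicit Types (alpha : R -> \bar R) (s t r y K : R).

Lemma classC_ge0 alpha t : classC alpha -> 0 <= t -> (0 <= alpha t)%E.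
Proof. by case=> H *; exact: H. Qed.

Lemma classC_0 alpha : classC alpha -> alpha 0 = 0%E.
Proof. by case. Qed.

Lemma classC_scale alpha (l t : R) : classC alpha -> 0 <= l <= 1 -> 0 <= t ->
  (alpha (l * t)%R <= l%:E * alpha t)%E.
Proof.
case=> _ a0 cvx _ l01 t0; have := cvx t 0 l t0 (lexx _) l01.
by rewrite mulr0 addr0 a0 mule0 adde0.
Qed.

Lemma classC_nondecreasing alpha s t : classC alpha -> 0 <= s -> s <= t ->
  (alpha s <= alpha t)%E.
Proof.
move=> ha s0 st; have [t0|t0] := leP t 0.
  by have -> : s = t by apply/eqP; rewrite eq_le st (le_trans t0).
have l01 : 0 <= s / t <= 1.
  by rewrite divr_ge0 ?(ltW t0)//= ler_pdivrMr// mul1r.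
have := @classC_scale alpha (s / t) t ha l01 (ltW t0).
rewrite divfK ?gt_eqF// => /le_trans; apply.
rewrite -[leRHS]mul1e lee_wpmul2r ?lee_fin ?(andP l01).2//.
exact: classC_ge0 ha (ltW t0).
Qed.

(** Lower semicontinuity only has content to the left of [t], since [alpha] is
    nondecreasing. *)
Lemma classC_lsc alpha t y : classC alpha -> 0 <= t -> (y%:E < alpha t)%E ->
  exists2 d, 0 < d & forall r, 0 <= r -> t - d < r -> (y%:E < alpha r)%E.
Proof.
move=> ha t0 yt; case: (ha) => _ _ _ lsc.
have [V + Vy] := lsc t y yt.
case: (@nbhs_subspaceP R [set t : R | 0 <= t] t) => // _ [e /= e0 eV].
exists e => // r r0 tr.
have [rt|tr'] := ltP r t; last first.
  exact: lt_le_trans yt (classC_nondecreasing _ _ _ ha t0 tr').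
apply: Vy; apply: eV => //=; rewrite /ball_ /= ltr_norml.
by apply/andP; split; lra.
Qed.

Lemma classC_cvg alpha : classC alpha ->
  alpha t @[t --> +oo] --> ereal_sup [set alpha t | t in [set t | 0 <= t]].
Proof.
move=> ha; pose beta t := alpha (Num.max 0 t).
have nd : nondecreasing_fun beta.
  move=> s t st; rewrite /beta; apply: classC_nondecreasing => //.
    by rewrite le_max lexx.
  by rewrite ge_max le_max lexx /= le_max st orbT.
have <- : range beta = [set alpha t | t in [set t | 0 <= t]].
  apply/seteqP; split=> [_ [t _ <-]|_ [t /= t0 <-]].
    by exists (Num.max 0 t) => //=; rewrite le_max lexx.
  by exists t => //; rewrite /beta max_r.
have := nondecreasing_cvge nd.
apply: cvg_trans; apply: near_eq_cvg; near=> t; rewrite /beta max_r//.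
Unshelve. all: by end_near. Qed.

Lemma extend_pinfty alpha : classC alpha ->
  extend alpha +oo%E = ereal_sup [set alpha t | t in [set t | 0 <= t]].
Proof. by move=> ha /=; apply/cvg_lim => //; exact: classC_cvg. Qed.

Lemma extend_ge alpha t (x : \bar R) : classC alpha -> 0 <= t ->
  (t%:E <= x)%E -> (alpha t <= extend alpha x)%E.
Proof.
move=> ha t0; case: x => [r| |]//.
- by rewrite lee_fin; exact: classC_nondecreasing.
- by move=> _; rewrite extend_pinfty//; apply: ereal_sup_ubound; exists t.
Qed.

(** Bounds on the conjugate are used in this form, which only mentions the real
    values of [alpha]. *)
Lemma mconj_le alpha s K : classC alpha ->
  (mconj alpha s <= K%:E)%E <->
  (forall t e, 0 <= t -> alpha t = e%:E -> s * t - e <= K).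
Proof.
move=> ha; split=> [H t e t0 te|H].
  rewrite -lee_fin; apply: le_trans H; rewrite EFinB -te.
  by apply: ereal_sup_ubound; exists t.
apply: ge_ereal_sup => _ [t /= t0 <-].
case E : (alpha t) => [e| |].
- by rewrite -EFinB lee_fin; exact: H.
- by rewrite /= leNye.
- by have := classC_ge0 _ _ ha t0; rewrite E.
Qed.

Lemma mconj_ge0 alpha s : classC alpha -> (0 <= mconj alpha s)%E.
Proof.
move=> ha; apply: ereal_sup_ubound; exists 0; rewrite /= ?lexx//.
by rewrite mulr0 classC_0// sube0.
Qed.

Lemma mconj_le_ge0 alpha s K : classC alpha ->
  (mconj alpha s <= K%:E)%E -> 0 <= K.
Proof. by move=> ha; rewrite -lee_fin; exact/le_trans/mconj_ge0. Qed.

(** The conjugate is convex and vanishes at 0, hence s |-> mconj alpha s / s is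
    nondecreasing. *)
Lemma mconj_scale alpha s t K : classC alpha -> 0 <= s -> s <= t -> 0 < t ->
  (mconj alpha t <= K%:E)%E -> (mconj alpha s <= (s / t * K)%:E)%E.
Proof.
move=> ha s0 st t0 /(mconj_le _ _ _ ha) H; apply/mconj_le => // r e r0 re.
have e0 : 0 <= e by have := classC_ge0 _ _ ha r0; rewrite re.
have l1 : s / t <= 1 by rewrite ler_pdivrMr// mul1r.
apply: (@le_trans _ _ (s / t * (t * r - e))); last first.
  by rewrite ler_wpM2l ?divr_ge0 ?(ltW t0)//; exact: H.
rewrite mulrBr mulrA divfK ?gt_eqF// lerB//.
by rewrite ler_piMl.
Qed.

Lemma mconj_nondecreasing alpha s t K : classC alpha -> 0 <= s -> s <= t ->
  (mconj alpha t <= K%:E)%E -> (mconj alpha s <= K%:E)%E.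
Proof.
move=> ha s0 st /(mconj_le _ _ _ ha) H; apply/mconj_le => // r e r0 re.
by apply: le_trans (H r e r0 re); rewrite lerD2r ler_wpM2r.
Qed.

(** One-dimensional Fenchel-Moreau theorem. The slope [s] is the largest of 0
    and of the slopes of the chords from (r, alpha r), r < t, to (t, y). These
    chords lie below those on the right of [t] by convexity, since (t, y) is
    below the graph, and their slopes are bounded because [alpha] stays above
    [y] on a neighborhood of [t]. *)
Lemma affine_minorant alpha t y : classC alpha -> 0 <= t -> 0 <= y ->
  (y%:E < alpha t)%E ->
  exists2 s, 0 <= s & (mconj alpha s <= (s * t - y)%:E)%E.
Proof.
move=> ha t0 y0 yt; have [d d0 Hd] := classC_lsc _ _ _ ha t0 yt.
pose S := [set z | z = 0 \/ exists r e,
  [/\ 0 <= r, r < t, alpha r = e%:E & z = (y - e) / (t - r)]].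
have S0 : S 0 by left.
have Sub r2 e2 : t < r2 -> alpha r2 = e2%:E -> ubound S ((e2 - y) / (r2 - t)).
  move=> tr2 re2 z [->|[r1 [e1 [r10 r1t re1 ->]]]].
    rewrite divr_ge0 ?subr_ge0 ?(ltW tr2)//.
    rewrite -lee_fin -re2 ltW// (lt_le_trans yt)//.
    by apply: classC_nondecreasing => //; exact: ltW.
  have [_ _ cvx _] := ha.
  pose l := (r2 - t) / (r2 - r1).
  have r20 : 0 <= r2 by rewrite (le_trans t0)// ltW.
  have l01 : 0 <= l <= 1.
    rewrite divr_ge0 ?subr_ge0 ?(ltW tr2) ?(ltW (lt_trans r1t tr2))//=.
    by rewrite ler_pdivrMr ?subr_gt0 ?(lt_trans r1t)// mul1r; lra.
  have := cvx r1 r2 l r10 r20 l01.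
  have -> : l * r1 + (1 - l) * r2 = t.
    rewrite /l; field; lra.
  rewrite re1 re2 -!EFinM -EFinD => /(lt_le_trans yt); rewrite lte_fin => yl.
  rewrite ler_pdivrMr ?subr_gt0// mulrAC ler_pdivlMr ?subr_gt0//.
  have : y * (r2 - r1) <= (l * e1 + (1 - l) * e2) * (r2 - r1).
    by rewrite ler_wpM2r ?(ltW yl)//; lra.
  have -> : (l * e1 + (1 - l) * e2) * (r2 - r1) =
     (r2 - t) * e1 + (t - r1) * e2 by rewrite /l; field; lra.
  by lra.
have Sb : has_ubound S.
  exists (y / d) => z [->|[r [e [r0 rt re ->]]]].
    by rewrite divr_ge0// ltW.
  have [ye|ye] := leP y e.
    rewrite (@le_trans _ _ 0) ?divr_ge0 ?(ltW d0)//.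
    by rewrite mulr_le0_ge0 ?invr_ge0; lra.
  have rd : d <= t - r.
    rewrite leNgt; apply/negP => rd.
    have := Hd r r0; rewrite re lte_fin => /(_ ltac:(lra)); lra.
  have e0 : 0 <= e by have := classC_ge0 _ _ ha r0; rewrite re.
  rewrite ler_pM ?invr_ge0//; [lra|lra|lra|].
  by rewrite lef_pV2 ?posrE//; lra.
exists (sup S).
  by apply: ub_le_sup => //.
apply/mconj_le => // r e r0 re.
have [rt|tr|rt] := ltgtP r t.
- have : (y - e) / (t - r) <= sup S.
    by apply: ub_le_sup => //; right; exists r, e.
  rewrite ler_pdivrMr ?subr_gt0//; lra.
- have : sup S <= (e - y) / (r - t).
    by apply: ge_sup; [exists 0|exact: Sub].
  rewrite ler_pdivlMr ?subr_gt0//; lra.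
- move: yt; rewrite -rt re lte_fin; lra.
Qed.

End CostFunctions.

(** * Relative entropy and the Gibbs variational principle *)

Section Entropy.
Context {d : measure_display} {T : measurableType d} {R : realType}.
Implicit Types (mu nu : probability T R) (psi : T -> R) (B K : R).

Lemma bounded_integrable mu psi B : measurable_fun [set: T] psi ->
  (forall x, `|psi x| <= B) -> mu.-integrable [set: T] (EFin \o psi).
Proof.
move=> mpsi psiB; apply: measurable_bounded_integrable => //.
  by rewrite /= probability_setT ltry.
exists B; split; rewrite ?num_real // => r Br x _ /=.
exact: le_trans (psiB x) (ltW Br).
Qed.

Lemma bounded_integralE mu psi B : measurable_fun [set: T] psi ->
  (forall x, `|psi x| <= B) ->
  (\int[mu]_x (psi x)%:E)%E = (\int[mu]_x psi x)%:E.
Proof.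
move=> mpsi psiB; rewrite /Rintegral fineK//.
exact: integrable_fin_num (bounded_integrable mu psi B mpsi psiB).
Qed.

Lemma measurable_superlevel psi (t : R) : measurable_fun [set: T] psi ->
  measurable [set x | t <= psi x].
Proof.
move=> mpsi; rewrite -[X in measurable X]setTI.
rewrite -[X in _ `&` X]/(psi @^-1` [set r | t <= r]) -set_itvcy.
exact: mpsi.
Qed.

(** Positive and negative parts are compared separately. The conventions on
    infinite values agree with the order, so this also covers functions whose
    integral is infinite, such as the logarithm of a density. *)
Lemma le_integral_measurable mu (f g : T -> \bar R) :
  measurable_fun [set: T] f -> measurable_fun [set: T] g ->
  (forall x, (f x <= g x)%E) -> (\int[mu]_x f x <= \int[mu]_x g x)%E.
Proof.
move=> mf mg fg; rewrite integralE [leRHS]integralE leeB//.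
- apply: ge0_le_integral => //; first exact: measurable_funepos.
  + exact: measurable_funepos.
  + by move=> x _; apply: (@funepos_le _ _ setT) => [? _|]; rewrite ?inE.
- apply: ge0_le_integral => //; first exact: measurable_funeneg.
  + exact: measurable_funeneg.
  + by move=> x _; apply: (@funeneg_le _ _ setT) => [? _|]; rewrite ?inE.
Qed.

Lemma measurable_lne (f : T -> \bar R) : measurable_fun [set: T] f ->
  (forall x, f x \is a fin_num) -> measurable_fun [set: T] (fun x => lne (f x)).
Proof.
move=> mf ff.
have -> : (fun x => lne (f x)) =
    (fun x => if fine (f x) <= 0 then -oo%E else (ln (fine (f x)))%:E).
  by apply/funext => x; rewrite -{1}(fineK (ff x)).
have mr : measurable_fun [set: T] (fine \o f) by exact: measurableT_comp.
apply: measurable_fun_ifT => //.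
  by apply: measurable_fun_ler.
by apply/measurable_EFinP; exact: measurableT_comp.
Qed.

(** Let f be the density of [nu] and h = e^(psi - K). By Jensen's inequality in
    its tangent form, ln f >= ln h + 1 - h / f, and int (h / f) dnu is at most
    int h dmu <= 1; integrating against [nu] gives the result. *)
Lemma donsker_varadhan mu nu psi B K : measurable_fun [set: T] psi ->
  (forall x, `|psi x| <= B) ->
  (\int[mu]_x (expR (psi x))%:E <= (expR K)%:E)%E ->
  ((\int[nu]_x psi x - K)%:E <= entropy nu mu)%E.
Proof.
move=> mpsi psiB expK; rewrite /entropy; case: asboolP => [numu|_]; last first.
  exact: leey.
pose f := Radon_Nikodym_SigmaFinite.f nu mu.
have f0 x : (0 <= f x)%E by exact: Radon_Nikodym_SigmaFinite.f_ge0.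
have ffin x : f x \is a fin_num by exact: Radon_Nikodym_SigmaFinite.f_fin_num.
have mf : measurable_fun [set: T] f.
  exact: measurable_int (Radon_Nikodym_SigmaFinite.f_integrable numu).
pose h x := expR (psi x - K).
have h0 x : 0 < h x by exact: expR_gt0.
have mh : measurable_fun [set: T] h.
  by apply: measurableT_comp => //; exact: measurable_funB.
(* [r] is a positive version of the density; the value [h] where the density
   vanishes is the one that makes the tangent inequality an equality there. *)
pose r x := if fine (f x) == 0 then h x else fine (f x).
have r0 x : 0 < r x.
  rewrite /r; case: ifPn => // fx0; rewrite lt_neqAle eq_sym fx0.
  by rewrite fine_ge0.
have mff : measurable_fun [set: T] (fine \o f) by exact: measurableT_comp.
have mr : measurable_fun [set: T] r.
  apply: measurable_fun_ifT => //.
  exact: measurable_fun_eqr.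
have mlnr : measurable_fun [set: T] (fun x => (ln (r x))%:E).
  by apply/measurable_EFinP; exact: measurableT_comp.
pose q x := expR (psi x - K - ln (r x)).
have mq : measurable_fun [set: T] q.
  apply: measurableT_comp => //; apply: measurable_funB => //.
    exact: measurable_funB.
  exact/measurable_EFinP.
have q0 x : 0 <= q x by exact: expR_ge0.
have -> : (\int[nu]_x lne (('d (charge_of_finite_measure nu) '/d mu) x) =
           \int[nu]_x (ln (r x))%:E)%E.
  apply: ae_eq_integral => //.
    by apply: measurable_lne => // x; exact: Radon_Nikodym_fin_num.
  have E1 : ae_eq nu [set: T] ('d (charge_of_finite_measure nu) '/d mu)%E f.
    apply: (null_dominates_ae_eq measurableT numu).
    exact/ae_eq_sym/ae_eq_Radon_Nikodym_SigmaFinite.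
  have E2 : {ae nu, forall x, fine (f x) != 0}.
    pose N := [set x | fine (f x) = 0].
    have mN : measurable N.
      by rewrite -[N]setTI; exact: (mff measurableT [set 0]).
    exists N; split=> // [|x /= /negP]; last by rewrite negbK => /eqP.
    rewrite (Radon_Nikodym_SigmaFinite.f_integral numu)//.
    by apply: integral0_eq => x Nx; rewrite -/f -(fineK (ffin x)) Nx.
  apply: filterS2 E1 E2 => x /(_ I) -> fx0 _.
  rewrite -(fineK (ffin x)) lne_EFin ?lt_neqAle 1?eq_sym ?fx0 ?fine_ge0//.
  by rewrite /r (negbTE fx0).
have q1 : (\int[nu]_x (q x)%:E <= 1)%E.
  rewrite -(Radon_Nikodym_SigmaFinite.change_of_variables numu)//; last first.
    exact/measurable_EFinP.
  have -> : 1%E = ((expR (- K))%:E * (expR K)%:E)%E :> \bar R.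
    by rewrite -EFinM -expRD addNr expR0.
  apply: (@le_trans _ _ (\int[mu]_x (h x)%:E)%E).
    apply: ge0_le_integral => //.
    - by move=> x _; rewrite mule_ge0// lee_fin.
    - by apply: emeasurable_funM => //; exact/measurable_EFinP.
    - exact/measurable_EFinP.
    move=> x _; rewrite -/f -(fineK (ffin x)) -EFinM lee_fin.
    have [->|fx0] := eqVneq (fine (f x)) 0; first by rewrite mulr0 ltW.
    by rewrite /q expRB lnK ?posrE// /r (negbTE fx0) divfK.
  under eq_integral do rewrite /h addrC expRD EFinM.
  rewrite ge0_integralZl//; first by rewrite lee_wpmul2l// lee_fin expR_ge0.
  by apply/measurable_EFinP; exact: measurableT_comp.
have iq : nu.-integrable [set: T] (EFin \o q).
  apply/integrableP; split; first exact/measurable_EFinP.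
  under eq_integral do rewrite gee0_abs ?lee_fin//.
  exact: le_lt_trans q1 (ltry _).
have mpsi1 : measurable_fun [set: T] (fun x => psi x + (1 - K)).
  exact: measurable_funD.
have psi1B x : `|psi x + (1 - K)| <= B + `|1 - K|.
  by rewrite (le_trans (ler_normD _ _))// lerD2r.
apply: (@le_trans _ _ (\int[nu]_x (psi x + (1 - K) - q x)%:E)%E).
  under eq_integral do rewrite EFinB.
  rewrite integralB_EFin//; last exact: bounded_integrable psi1B.
  under eq_integral do rewrite EFinD.
  rewrite integralD_EFin//; last 2 first.
  - exact: bounded_integrable psiB.
  - exact: (bounded_integrable nu (cst (1 - K)) `|1 - K|).
  rewrite (bounded_integralE nu _ B)// integral_cst//.
  rewrite [X in (_ * X)%E]probability_setT mule1.
  have /fineK <- : (\int[nu]_x (q x)%:E)%E \is a fin_num.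
    exact: integrable_fin_num iq.
  rewrite -EFinD lee_fin.
  have : (fine (\int[nu]_x (q x)%:E) <= 1)%R.
    rewrite -lee_fin fineK//; exact: integrable_fin_num iq.
  lra.
apply: le_integral_measurable => //.
  by apply/measurable_EFinP; exact: measurable_funB.
move=> x; rewrite lee_fin /q.
have := expR_ge1Dx (psi x - K - ln (r x)); lra.
Qed.


End Entropy.

Definition density_measure {d} {T : measurableType d} {R : realType}
  (mu : probability T R) (g : T -> R) : set T -> \bar R :=
  fun A => (\int[mu]_(x in A) (g x)%:E)%E.

Section DensityProbability.
Context {d : measure_display} {T : measurableType d} {R : realType}.
Variables (mu : probability T R) (g : T -> R).
Hypotheses (mg : measurable_fun [set: T] g) (g_ge0 : forall x, 0 <= g x).
Hypothesis g1 : (\int[mu]_x (g x)%:E = 1)%E.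

Let density0 : density_measure mu g set0 = 0%E.
Proof. by rewrite /density_measure integral_set0. Qed.

Let density_ge0 A : (0 <= density_measure mu g A)%E.
Proof. by apply: integral_ge0 => x _; rewrite lee_fin. Qed.

Let density_sigma_additive : semi_sigma_additive (density_measure mu g).
Proof.
move=> /= F mF tF mUF; rewrite /density_measure; apply: cvg_toP.
  apply: ereal_nondecreasing_is_cvgn => m n mn.
  apply: lee_sum_nneg_natr => // k _ _; apply: integral_ge0 => /= x _.
  by rewrite lee_fin.
rewrite ge0_integral_bigcup//=; last by move=> x _; rewrite lee_fin.
by apply/measurable_EFinP; exact: measurable_funTS.
Qed.

HB.instance Definition _ := isMeasure.Build _ _ _
  (density_measure mu g) density0 density_ge0 density_sigma_additive.

Let density_setT : density_measure mu g [set: T] = 1%E.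
Proof. exact: g1. Qed.

HB.instance Definition _ :=
  @Measure_isProbability.Build _ _ R (density_measure mu g) density_setT.

(** Only the values of the measure matter for its relative entropy, so the
    concrete construction is forgotten. *)
Lemma density_probability : exists nu : probability T R,
  forall A, nu A = (\int[mu]_(x in A) (g x)%:E)%E.
Proof. by exists (density_measure mu g : probability T R). Qed.

End DensityProbability.

Section Tilt.
Context {d : measure_display} {T : measurableType d} {R : realType}.
Implicit Types (mu nu : probability T R) (psi : T -> R) (B K : R).

Lemma exp_integral_fin mu psi B : measurable_fun [set: T] psi ->
  (forall x, `|psi x| <= B) -> exists2 Z : R, 0 < Z &
  (\int[mu]_x (expR (psi x))%:E)%E = Z%:E.
Proof.
move=> mpsi psiB.
have mexp : measurable_fun [set: T] (fun x => expR (psi x)).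
  exact: measurableT_comp.
have expB x : `|expR (psi x)| <= expR B.
  by rewrite ger0_norm ?expR_ge0// ler_expR (le_trans (ler_norm _)).
have intE := bounded_integralE mu _ _ mexp expB.
exists (\int[mu]_x expR (psi x)); last exact: intE.
apply: (@lt_le_trans _ _ (expR (- B))); first exact: expR_gt0.
rewrite -lee_fin -intE.
have -> : (expR (- B))%:E = (\int[mu]_x (expR (- B))%:E)%E.
  by rewrite integral_cst// [X in (_ * X)%E]probability_setT mule1.
apply: ge0_le_integral => //.
- exact/measurable_EFinP.
- move=> x _; rewrite lee_fin ler_expR lerNl.
  by rewrite (le_trans (ler_norm _))// normrN.
Qed.

(** The measure with density e^psi / Z realizes equality in the variational
    principle. *)
Lemma gibbs_attained mu psi B Z : measurable_fun [set: T] psi ->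
  (forall x, `|psi x| <= B) -> 0 < Z ->
  (\int[mu]_x (expR (psi x))%:E)%E = Z%:E ->
  exists nu : probability T R,
    entropy nu mu = (\int[nu]_x psi x - ln Z)%:E.
Proof.
move=> mpsi psiB Z0 intZ.
pose g x := expR (psi x - ln Z).
have mg : measurable_fun [set: T] g.
  by apply: measurableT_comp => //; exact: measurable_funB.
have g0 x : 0 < g x by exact: expR_gt0.
have g1 : (\int[mu]_x (g x)%:E = 1)%E.
  under eq_integral do rewrite /g addrC expRD EFinM.
  rewrite ge0_integralZl//; last 1 first.
  - by apply/measurable_EFinP; exact: measurableT_comp.
  by rewrite intZ -EFinM expRN lnK ?posrE// mulVf// gt_eqF.
have [nu nuE] := density_probability mu g mg (fun x => ltW (g0 x)) g1.
exists nu; have numu : nu `<< mu.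
  apply/null_content_dominatesP => A mA muA0.
  by rewrite nuE null_set_integral//; exact/measurable_EFinP/measurable_funTS.
rewrite /entropy asboolT//.
have dE : ae_eq nu [set: T] ('d (charge_of_finite_measure nu) '/d mu)%E
    (EFin \o g).
  apply: (null_dominates_ae_eq measurableT numu).
  apply: integral_ae_eq => //; first exact: Radon_Nikodym_integrable.
    exact/measurable_EFinP.
  move=> A _ mA; rewrite -Radon_Nikodym_integral//; exact: nuE.
have mpsiZ : measurable_fun [set: T] (fun x => psi x + - ln Z).
  exact: measurable_funD.
transitivity (\int[nu]_x (psi x + - ln Z)%:E)%E.
  apply: ae_eq_integral => //.
  - by apply: measurable_lne => // x; exact: Radon_Nikodym_fin_num.
  - exact/measurable_EFinP.
  apply: filterS dE => x /(_ I) -> _.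
  by rewrite /comp lne_EFin ?g0// /g expRK.
under eq_integral do rewrite EFinD.
rewrite integralD_EFin//; last 2 first.
- exact: bounded_integrable psiB.
- exact: (bounded_integrable nu (cst (- ln Z)) `|- ln Z|).
rewrite (bounded_integralE nu _ B)// integral_cst//.
by rewrite [X in (_ * X)%E]probability_setT mule1.
Qed.

End Tilt.

(** * Transport inequalities as bounds on Laplace transforms *)

(** This is log (int e^(s X) dmu) <= mconj alpha (a s). Quantifying over the
    real majorants [K] of the conjugate avoids extended logarithms, and makes
    the condition void where the conjugate is infinite. *)
Definition laplace_bound {d} {T : measurableType d} {R : realType}
    (alpha : R -> \bar R) (mu : probability T R) (a : R) (X : T -> R) : Prop :=
  forall s K, 0 <= s -> (mconj alpha (a * s) <= K%:E)%E ->
  (\int[mu]_x (expR (s * X x))%:E <= (expR K)%:E)%E.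

Section Duality.
Context {d : measure_display} {T : measurableType d} {R : realType}.
Implicit Types (mu nu : probability T R) (phi : T -> R) (Phi : set (T -> R)).
Implicit Types (alpha : R -> \bar R) (a s K B c : R).

Lemma entropy_ge0 mu nu : (0 <= entropy nu mu)%E.
Proof.
have := donsker_varadhan mu nu (cst 0) 0 0.
rewrite Rintegral_cst// mul0r subr0; apply=> //.
- by move=> x; rewrite normr0.
- by rewrite /= expR0 integral_cst// [X in (_ * X)%E]probability_setT mule1.
Qed.

Lemma Rintegral_affine nu phi B s c : measurable_fun [set: T] phi ->
  (forall x, `|phi x| <= B) ->
  \int[nu]_x (s * (phi x - c)) = s * (\int[nu]_x phi x - c).
Proof.
move=> mphi phiB; have iphi := bounded_integrable nu phi B mphi phiB.
have ic : nu.-integrable [set: T] (EFin \o cst c).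
  exact: (bounded_integrable nu (cst c) `|c|).
rewrite RintegralZl//; last first.
  apply: (bounded_integrable nu _ (B + `|c|)).
    exact: measurable_funB.
  by move=> x; rewrite (le_trans (ler_normB _ _))// lerD2r.
rewrite RintegralB// Rintegral_cst//.
by rewrite [X in fine X]probability_setT mulr1.
Qed.

Lemma Rintegral_opp nu phi B : measurable_fun [set: T] phi ->
  (forall x, `|phi x| <= B) ->
  \int[nu]_x (- phi x) = - \int[nu]_x phi x.
Proof.
move=> mphi phiB; have := Rintegral_affine nu phi B (-1) 0 mphi phiB.
rewrite subr0 mulN1r => <-; apply: eq_Rintegral => x _.
by rewrite subr0 mulN1r.
Qed.

Lemma measurable_affine phi s c : measurable_fun [set: T] phi ->
  measurable_fun [set: T] (fun x => s * (phi x - c)).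
Proof.
by move=> mphi; apply: measurable_funM => //; exact: measurable_funB.
Qed.

Lemma bounded_affine phi B s c : (forall x, `|phi x| <= B) ->
  forall x, `|s * (phi x - c)| <= `|s| * (B + `|c|).
Proof.
move=> phiB x; rewrite normrM ler_wpM2l//.
by rewrite (le_trans (ler_normB _ _))// lerD2r.
Qed.

Lemma dual_norm_ge Phi nu mu phi : Phi phi ->
  ((\int[nu]_x phi x - \int[mu]_x phi x)%:E <= dual_norm Phi nu mu)%E.
Proof. by move=> Pphi; apply: ereal_sup_ubound; exists phi. Qed.

(** Apply the transport inequality to the measure tilted by e^(s phi), for
    which the entropy is s <phi, nu> - ln Z exactly, and bound alpha from below
    by the affine function attached to a s. *)
Lemma transport_laplace alpha Phi mu a phi B : classC alpha -> 0 < a ->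
  transport_inequality alpha Phi mu a ->
  Phi phi -> measurable_fun [set: T] phi -> (forall x, `|phi x| <= B) ->
  laplace_bound alpha mu a (fun x => phi x - \int[mu]_z phi z).
Proof.
move=> ha a0 transp Pphi mphi phiB s K s0 HK.
set c := \int[mu]_z phi z.
have mpsi := measurable_affine phi s c mphi.
have psiB := bounded_affine phi B s c phiB.
have [Z Z0 intZ] := exp_integral_fin mu _ _ mpsi psiB.
have [nu entE] := gibbs_attained mu _ _ Z mpsi psiB Z0 intZ.
rewrite intZ lee_fin -ler_ln ?posrE ?expR_gt0// expRK.
have := entropy_ge0 mu nu; have := transp nu.
rewrite entE (Rintegral_affine nu _ B)// !lee_fin.
have := dual_norm_ge Phi nu mu phi Pphi; rewrite -/c.
set D := \int[nu]_x phi x - c => Ddual tr h0.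
have K0 := mconj_le_ge0 _ _ _ ha HK.
have [D0|D0] := ltP D 0.
  have sD : s * D <= 0 by rewrite mulr_ge0_le0// ltW.
  lra.
have Da : ((D / a)%:E <= dual_norm Phi nu mu / a%:E)%E.
  by rewrite inver gt_eqF// EFinM lee_wpmul2r// lee_fin invr_ge0 ltW.
have Da0 : 0 <= D / a by rewrite divr_ge0// ltW.
have := le_trans (extend_ge _ _ _ ha Da0 Da) tr.
have := classC_ge0 _ _ ha Da0.
case E : (alpha (D / a)) => [e| |]//; rewrite !lee_fin => e0 eh.
have /(mconj_le _ _ _ ha) /(_ _ _ Da0 E) := HK.
have -> : a * s * (D / a) = s * D by field; rewrite gt_eqF.
lra.
Qed.

(** Constants [a'] larger than [a] are enough, because the strict inequality
    that is contradicted leaves some room; this is what makes it possible to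
    use Luxemburg norms, which are infima, without showing that they are
    attained. *)
Lemma laplace_deviation alpha mu nu a phi B h : classC alpha -> 0 < a ->
  measurable_fun [set: T] phi -> (forall x, `|phi x| <= B) ->
  (forall a', a < a' ->
    laplace_bound alpha mu a' (fun x => phi x - \int[mu]_z phi z)) ->
  entropy nu mu = h%:E -> 0 <= \int[nu]_x phi x - \int[mu]_x phi x ->
  (alpha ((\int[nu]_x phi x - \int[mu]_x phi x) / a)%R <= h%:E)%E.
Proof.
move=> ha a0 mphi phiB lap hE.
set c := \int[mu]_z phi z; set D := _ - c => D0.
have h0 : 0 <= h by rewrite -lee_fin -hE entropy_ge0.
rewrite leNgt; apply/negP => hlt.
have [y hy yalpha] : exists2 y, h < y & (y%:E < alpha (D / a)%R)%E.
  move: hlt; case: (alpha (D / a)) => [e| |]//.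
    by rewrite lte_fin => he; exists ((h + e) / 2); rewrite ?lte_fin; lra.
  by move=> _; exists (h + 1); rewrite ?ltry//; lra.
have Da0 : 0 <= D / a by rewrite divr_ge0// ltW.
have [sigma sigma0 Hs] :=
  affine_minorant _ _ _ ha Da0 (le_trans h0 (ltW hy)) yalpha.
pose w := sigma * (D / a).
have w0 : 0 <= w by rewrite mulr_ge0.
(* [e] is small enough for the loss w e caused by a' = a (1 + e) to stay below
   the gap y - h. *)
pose e := (y - h) / (w + 1).
have e0 : 0 < e by rewrite divr_gt0//; lra.
have we : w * e < y - h.
  rewrite /e mulrA ltr_pdivrMr; last lra.
  rewrite mulrC ltr_pM2l; lra.
pose a' := a * (1 + e).
have a'0 : 0 < a' by rewrite mulr_gt0//; lra.
have aa' : a < a' by rewrite /a' ltr_pMr//; lra.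
pose s := sigma / a'.
have s0 : 0 <= s by rewrite divr_ge0// ltW.
have mpsi := measurable_affine phi s c mphi.
have psiB := bounded_affine phi B s c phiB.
have L : (\int[mu]_x (expR (s * (phi x - c)))%:E <=
          (expR (w - y))%:E)%E.
  by apply: lap aa' _ _ s0 _; rewrite /s mulrC divfK// gt_eqF.
have := donsker_varadhan mu nu _ _ _ mpsi psiB L.
rewrite hE lee_fin (Rintegral_affine nu _ B)// -/D.
have -> : s * D = w / (1 + e) by rewrite /s /w /a'; field; lra.
have : w * (1 - e) <= w / (1 + e).
  rewrite ler_wpM2l// -[leRHS]mul1r ler_pdivlMr; [|lra].
  have : 0 <= e * e by rewrite mulr_ge0// ltW.
  lra.
lra.
Qed.

(** The deviations of the single functions are bounded by
    [laplace_deviation]; lower semicontinuity of [alpha] transfers the bound to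
    their supremum, and symmetry of [Phi] makes that supremum nonnegative. *)
Lemma laplace_transport alpha Phi mu a : classC alpha -> 0 < a ->
  (forall phi, Phi phi -> measurable_fun [set: T] phi) ->
  (forall phi, Phi phi -> exists B, forall x, `|phi x| <= B) ->
  (forall phi, Phi phi -> Phi (fun x => - phi x)) ->
  (forall phi a', Phi phi -> a < a' ->
    laplace_bound alpha mu a' (fun x => phi x - \int[mu]_z phi z)) ->
  transport_inequality alpha Phi mu a.
Proof.
move=> ha a0 mPhi PhiB PhiN lap nu.
have := entropy_ge0 mu nu.
case hE : (entropy nu mu) => [h| |]//; last by move=> _; exact: leey.
rewrite lee_fin => h0.
pose D phi := \int[nu]_x phi x - \int[mu]_x phi x.
have dev phi : Phi phi -> 0 <= D phi -> (alpha (D phi / a)%R <= h%:E)%E.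
  move=> Pphi D0; have [B phiB] := PhiB _ Pphi.
  apply: (laplace_deviation _ _ _ _ _ B) => //; first exact: mPhi.
  by move=> a' /lap; exact.
have DN phi : Phi phi -> D (fun x => - phi x) = - D phi.
  move=> Pphi; have [B phiB] := PhiB _ Pphi.
  by rewrite /D !(Rintegral_opp _ _ B (mPhi _ Pphi) phiB) opprB opprK addrC.
case SE : (dual_norm Phi nu mu) => [S| |].
- rewrite inver gt_eqF// -EFinM /=.
  have DS phi : Phi phi -> D phi <= S.
    by move=> Pphi; rewrite -lee_fin -SE; exact: dual_norm_ge.
  have [phi0 Phi0] : Phi !=set0.
    apply/set0P/eqP => P0; move: SE.
    by rewrite /dual_norm P0 image_set0 ereal_sup0.
  have S0 : 0 <= S.
    have := DS _ Phi0; have := DS _ (PhiN _ Phi0); rewrite DN//; lra.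
  rewrite leNgt; apply/negP => hS.
  have Sa0 : 0 <= S / a by rewrite divr_ge0// ltW.
  have [e e0 He] := classC_lsc _ _ _ ha Sa0 hS.
  have : ((S - a * e)%:E < dual_norm Phi nu mu)%E.
    by rewrite SE lte_fin ltrBlDr ltrDl mulr_gt0.
  move=> /ereal_sup_gt [_ [phi Pphi <-]]; rewrite lte_fin -/(D phi) => De.
  have De' : S / a - e < D phi / a.
    by rewrite ltr_pdivlMr// mulrBl divfK ?gt_eqF// [e * a]mulrC.
  have [D0|D0] := leP 0 (D phi).
    have Da0 : 0 <= D phi / a by rewrite divr_ge0// ltW.
    by have := lt_le_trans (He _ Da0 De') (dev _ Pphi D0); rewrite ltxx.
  have S0e : S / a - e < 0.
    by rewrite (lt_trans De')// pmulr_llt0// invr_gt0.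
  have := He 0 (lexx _) S0e.
  by rewrite classC_0// lte_fin ltNge h0.
- have -> : (+oo / a%:E = +oo :> \bar R)%E.
    by rewrite inver gt_eqF// mulyr gtr0_sg ?mul1e// invr_gt0.
  rewrite extend_pinfty//; apply: ge_ereal_sup => _ [t /= t0 <-].
  have : ((a * t)%:E < dual_norm Phi nu mu)%E by rewrite SE ltry.
  move=> /ereal_sup_gt [_ [phi Pphi <-]]; rewrite lte_fin -/(D phi) => Dt.
  have tD : t <= D phi / a by rewrite ler_pdivlMr// mulrC ltW.
  apply: le_trans (dev _ Pphi _); first exact: classC_nondecreasing.
  by rewrite (le_trans _ (ltW Dt))// mulr_ge0// ltW.
- have -> : (-oo / a%:E = -oo :> \bar R)%E.
    by rewrite inver gt_eqF// mulNyr gtr0_sg ?mul1e// invr_gt0.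
  by rewrite /= lee_fin.
Qed.

End Duality.

(** * Tails of functions with controlled Laplace transform *)

Section Tails.
Context {d : measure_display} {T : measurableType d} {R : realType}.
Implicit Types (mu nu : probability T R) (X : T -> R).
Implicit Types (alpha : R -> \bar R) (a s t y K B c : R).

Lemma exponential_markov mu X s t : 0 <= s -> measurable_fun [set: T] X ->
  ((expR (s * t))%:E * mu [set x | (t <= X x)%R] <=
   \int[mu]_x (expR (s * X x))%:E)%E.
Proof.
move=> s0 mX; set A := [set x | t <= X x].
have mA : measurable A by exact: measurable_superlevel.
have mexp : measurable_fun [set: T] (fun x => (expR (s * X x))%:E).
  apply/measurable_EFinP; apply: measurableT_comp => //.
  exact: measurable_funM.
rewrite -integral_cst//.
apply: (@le_trans _ _ (\int[mu]_(x in A) (expR (s * X x))%:E)%E).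
  apply: ge0_le_integral => //.
  - by move=> x _; rewrite lee_fin expR_ge0.
  - exact: measurable_funTS.
  - by move=> x /= Ax; rewrite lee_fin ler_expR ler_wpM2l.
by apply: ge0_subset_integral => // x _; rewrite lee_fin expR_ge0.
Qed.

(** Chernoff's bound, with the exponent given by an affine minorant of [alpha]
    at [t]. *)
Lemma laplace_tail alpha mu a X t y : classC alpha -> 0 < a ->
  measurable_fun [set: T] X -> laplace_bound alpha mu a X ->
  0 <= t -> 0 <= y -> (y%:E < alpha t)%E ->
  (mu [set x | (a * t <= X x)%R] <= (expR (- y))%:E)%E.
Proof.
move=> ha a0 mX lap t0 y0 yt.
have [sigma sigma0 Hs] := affine_minorant _ _ _ ha t0 y0 yt.
have s0 : 0 <= sigma / a by rewrite divr_ge0// ltW.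
have := exponential_markov mu X _ (a * t) s0 mX.
have asE : a * (sigma / a) = sigma by rewrite mulrC divfK// gt_eqF.
have L : (mconj alpha (a * (sigma / a))%R <= (sigma * t - y)%:E)%E.
  by rewrite asE.
move=> /le_trans /(_ (lap _ _ s0 L)).
rewrite mulrA divfK ?gt_eqF// muleC -lee_pdivlMr ?expR_gt0// => /le_trans.
apply.
rewrite -EFinM lee_fin -expRN -expRD ler_expR; lra.
Qed.

Lemma laplace_tail_abs alpha mu a X t y : classC alpha -> 0 < a ->
  measurable_fun [set: T] X -> laplace_bound alpha mu a X ->
  laplace_bound alpha mu a (fun x => - X x) ->
  0 <= t -> 0 <= y -> (y%:E < alpha t)%E ->
  (mu [set x | (t <= `|X x| / a)%R] <= (2 * expR (- y))%:E)%E.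
Proof.
move=> ha a0 mX lapp lapn t0 y0 yt.
have mNX : measurable_fun [set: T] (fun x => - X x) by exact: measurable_funN.
have -> : [set x | t <= `|X x| / a] =
    [set x | a * t <= X x] `|` [set x | a * t <= - X x].
  apply/seteqP; split=> x /=; rewrite ler_pdivlMr// mulrC ler_normr.
    by case/orP; [left|right].
  by case=> ->; rewrite ?orbT.
apply: le_trans (measureU2 _ _ _) _;
  [exact: measurable_superlevel|exact: measurable_superlevel|].
have -> : 2 * expR (- y) = expR (- y) + expR (- y) by rewrite -mulr2n mulr_natl.
rewrite EFinD leeD//.
- exact: laplace_tail lapp t0 y0 yt.
- exact: laplace_tail lapn t0 y0 yt.
Qed.

Lemma measurable_nondecreasing (g : R -> \bar R) (f : T -> R) :
  (forall s t, 0 <= s -> s <= t -> (g s <= g t)%E) ->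
  measurable_fun [set: T] f -> (forall x, 0 <= f x) ->
  measurable_fun [set: T] (fun x => g (f x)).
Proof.
move=> gnd mf f0.
pose h t := g (Num.max 0 t).
have -> : (fun x => g (f x)) = h \o f.
  by apply/funext => x; rewrite /h /= max_r.
apply: measurableT_comp mf.
apply: (measurability _ (ErealGenOInfty.measurableE R)).
move=> /= _ [_ [b ->]] <-; apply: measurableI => //.
rewrite preimage_itvoy.
apply: is_interval_measurable => s t /= hs ht u /andP[su ut].
apply: lt_le_trans hs _; rewrite /h; apply: gnd.
  by rewrite le_max lexx.
by rewrite ge_max le_max lexx /= le_max su orbT.
Qed.

(** The set of the t with alpha t > y is an up-closed interval. If it contains
    its infimum, this is the tail bound there; otherwise the event is an
    increasing union of events {|X| / a >= t_n} with alpha t_n > y. *)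
Lemma laplace_level alpha mu a X y : classC alpha -> 0 < a ->
  measurable_fun [set: T] X -> laplace_bound alpha mu a X ->
  laplace_bound alpha mu a (fun x => - X x) -> 0 <= y ->
  (mu [set x | (y%:E < alpha (`|X x| / a)%R)%E] <= (2 * expR (- y))%:E)%E.
Proof.
move=> ha a0 mX lapp lapn y0.
pose V x := `|X x| / a.
have V0 x : 0 <= V x by rewrite divr_ge0// ltW.
have mV : measurable_fun [set: T] V.
  by apply: measurable_funM => //; exact: measurableT_comp.
pose U := [set t | 0 <= t /\ (y%:E < alpha t)%E].
pose A := [set x | (y%:E < alpha (V x))%E].
have AU : A = V @^-1` U by apply/seteqP; split=> x /=; [split|case].
have Aup x t : U t -> t <= V x -> A x.
  move=> [t0 yt] tV; apply: (lt_le_trans yt); exact: classC_nondecreasing.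
have tail t : U t -> (mu [set x | (t <= V x)%R] <= (2 * expR (- y))%:E)%E.
  by move=> [t0 yt]; exact: (laplace_tail_abs alpha mu a X).
have [[u0 Uu0]|UN] := pselect (U !=set0); last first.
  have A0 : A = set0.
    rewrite -subset0 => x; rewrite AU => Ux; apply: UN; exists (V x) => //.
  by rewrite -/A A0 measure0 lee_fin mulr_ge0// expR_ge0.
have U0 : has_lbound U by exists 0 => t [].
have Umono s t : U s -> s <= t -> U t.
  move=> [s0 ys] st; split; first exact: le_trans st.
  exact: lt_le_trans ys (classC_nondecreasing _ _ _ ha s0 st).
pose t0 := inf U.
have t0V x : A x -> t0 <= V x by rewrite AU => /= Ux; exact: ge_inf.
have [Ut0|NUt0] := pselect (U t0).
  apply: le_trans (tail _ Ut0); rewrite -/A.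
  have -> : A = [set x | t0 <= V x].
    by apply/seteqP; split=> x /=; [exact: t0V|exact: Aup].
  exact: lexx.
pose F n := [set x | t0 + n.+1%:R^-1 <= V x].
have UF n : U (t0 + n.+1%:R^-1).
  have [||u Uu ut] := @inf_adherent R U n.+1%:R^-1.
  - by rewrite invr_gt0.
  - by split=> //; exists u0.
  by apply: Umono Uu _; exact: ltW.
have AF : A = \bigcup_n F n.
  apply/seteqP; split=> [x Ax|x [n _] /= Fnx]; last exact: Aup (UF n) Fnx.
  have : t0 < V x.
    rewrite lt_neqAle t0V// andbT; apply/eqP => t0E; apply: NUt0.
    by move: Ax; rewrite AU /= -t0E.
  by move=> /ltr_add_invr[k kV]; exists k => //; exact: ltW.
rewrite -/A AF.
have mF n : measurable (F n) by exact: measurable_superlevel.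
apply: cvge_le (nondecreasing_cvg_mu mF (bigcup_measurable _) _) => //.
- by near=> n; exact: tail.
- move=> m n mn; apply/subsetPset => x /=; apply: le_trans.
  by rewrite lerD2l lef_pV2 ?posrE// ler_nat.
Unshelve. all: by end_near. Qed.

Lemma integral_cube_tail :
  (\int[lebesgue_measure]_(z in `[0%R, +oo[)
     (2 * ((1 + z)^-1) ^+ 3)%:E = 1 :> \bar R)%E.
Proof.
pose v (z : R) : R := (1 + z)^-1.
have dv (z : R) : 0 <= z -> is_derive z 1 v (- v z ^+ 2).
  move=> z0; have z1 : 1 + z != 0 by rewrite gt_eqF//; lra.
  apply: DeriveDef; first exact: derivableV.
  rewrite deriveV// derive_val /v exprVn.
  by rewrite add0r [LHS]mulr1.
pose F (z : R) : R := - v z ^+ 2.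
have dF (z : R) : 0 <= z -> is_derive z 1 F (2 * v z ^+ 3).
  move=> z0; have := dv z z0 => ?.
  apply: is_derive_eq.
  by rewrite /GRing.scale/=; ring.
have cont (G : R -> R) (z g : R) : is_derive z 1 G g -> {for z, continuous G}.
  move=> dG; apply: differentiable_continuous; exact/derivable1_diffP.
have vy : v z @[z --> +oo] --> 0.
  apply/gtr0_cvgV0; last exact: cvg_addrl.
  by near=> z; rewrite addr_gt0.
have cv (z : R) : 0 <= z -> {for z, continuous v}.
  by move=> /dv; exact: cont.
have cf (z : R) : 0 <= z -> {for z, continuous (fun z => 2 * v z ^+ 3)}.
  move=> z0; apply: (cont _ _ (2 * (3 * v z ^+ 2 * - v z ^+ 2))).
  have := dv z z0 => ?; apply: is_derive_eq.
  by rewrite /GRing.scale/=; ring.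
rewrite (@ge0_continuous_FTC2y R _ F 0 0)//.
- by rewrite /F /v addr0 invr1 expr1n sub0e EFinN oppeK.
- by move=> z z0; rewrite mulr_ge0// exprn_ge0// invr_ge0 addr_ge0.
- apply/continuous_within_itvcyP; split.
    by move=> z; rewrite in_itv/= andbT => /ltW; exact: cf.
  by apply: cvg_at_right_filter; exact: cf.
- rewrite /F -oppr0; apply: cvgN.
  have -> : (0 : R) = 0 ^+ 2 by rewrite expr0n.
  by apply: (cvg_comp v (fun r => r ^+ 2) vy); exact: exprn_continuous.
- by move=> z /ltW /dF [].
- by apply: cvg_at_right_filter; apply: cont; exact: dF.
- move=> z; rewrite in_itv/= andbT => /ltW z0.
  by rewrite derive1E; have [_ ->] := dF z z0.
Unshelve. all: by end_near. Qed.

End Tails.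

(** * From Laplace transforms to Luxemburg norms *)

Section LaplaceToLuxemburg.
Context {d : measure_display} {T : measurableType d} {R : realType}.
Implicit Types (mu nu : probability T R) (X : T -> R).
Implicit Types (alpha : R -> \bar R) (a s t y K B c : R).

Lemma tau_nondecreasing alpha s t : classC alpha -> 0 <= s -> s <= t ->
  (tau alpha s <= tau alpha t)%E.
Proof.
move=> ha s0 st; rewrite /tau leeB// lee_expeR; exact: classC_nondecreasing.
Qed.

Lemma tau_ge0 alpha t : classC alpha -> 0 <= t -> (0 <= tau alpha t)%E.
Proof.
move=> ha t0; have := classC_ge0 _ _ ha t0; rewrite /tau.
case: (alpha t) => [e| |]//.
by rewrite lee_fin => e0; rewrite /= -EFinB lee_fin subr_ge0 -expR0 ler_expR.
Qed.

Lemma integral_power_tail :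
  (\int[lebesgue_measure]_(z in `[0%R, +oo[)
     (2 * expR (- (3 * ln (1 + z))))%:E = 1 :> \bar R)%E.
Proof.
rewrite -[RHS]integral_cube_tail; apply: eq_integral => z.
rewrite inE /= in_itv/= andbT => z0; have z1 : 0 < 1 + z by lra.
by rewrite expRN expRM_natl lnK ?posrE// exprVn.
Qed.

(** With Z = e^(alpha (|X| / (3 a))) - 1, the layer cake formula reduces the
    claim to the tail bound mu (Z > z) <= 2 (1 + z)^(-3), which follows from
    [laplace_level] at y = 3 ln (1 + z) and from
    alpha (t / 3) <= alpha t / 3. *)
Lemma laplace_luxemburg alpha mu a X : classC alpha -> 0 < a ->
  measurable_fun [set: T] X -> laplace_bound alpha mu a X ->
  laplace_bound alpha mu a (fun x => - X x) ->
  (luxemburg mu alpha X <= (3 * a)%:E)%E.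
Proof.
move=> ha a0 mX lapp lapn; apply: ereal_inf_lbound.
exists (3 * a) => //; split; first by rewrite mulr_gt0.
have V0 x : 0 <= `|X x| / (3 * a) by rewrite divr_ge0// mulr_ge0// ltW.
have mV : measurable_fun [set: T] (fun x => `|X x| / (3 * a)).
  by apply: measurable_funM => //; exact: measurableT_comp.
pose A x := alpha (`|X x| / (3 * a)).
have A0 x : (0 <= A x)%E by exact: classC_ge0.
have mA : measurable_fun [set: T] A.
  apply: measurable_nondecreasing => // s t.
  exact: classC_nondecreasing.
have mtau : measurable_fun [set: T] (fun x => tau alpha (`|X x| / (3 * a))).
  apply: measurable_nondecreasing => // s t.
  exact: tau_nondecreasing.
have level y : 0 <= y ->
    (mu [set x | (y%:E < A x)%E] <= (2 * expR (- (3 * y)))%:E)%E.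
  move=> y0; have y30 : 0 <= 3 * y by rewrite mulr_ge0.
  apply: le_trans (laplace_level _ _ _ _ _ ha a0 mX lapp lapn y30).
  have mUp (f : T -> \bar R) z : measurable_fun [set: T] f ->
      measurable [set x | (z%:E < f x)%E].
    move=> mf; rewrite -[X in measurable X]setTI.
    exact: emeasurable_fun_o_infty.
  apply: le_measure; rewrite ?inE.
  - exact: mUp.
  - apply: mUp; apply: measurable_nondecreasing.
    + by move=> s t; exact: classC_nondecreasing.
    + by apply: measurable_funM => //; exact: measurableT_comp.
    + by move=> x; rewrite divr_ge0// ltW.
  move=> x /= yA.
  have Va : 0 <= `|X x| / a by rewrite divr_ge0// ltW.
  have l3 : 0 <= (3^-1 : R) <= 1 by lra.
  have := classC_scale _ _ _ ha l3 Va.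
  have -> : 3^-1 * (`|X x| / a) = `|X x| / (3 * a) by field; lra.
  move=> /(lt_le_trans yA).
  case: (alpha _) => [e| |]//; last 2 first.
  - by move=> _; exact: ltry.
  - by rewrite mulrNy gtr0_sg// mul1e.
  by rewrite -EFinM !lte_fin; lra.
pose Z x := expR (fine (A x)) - 1.
have Z0 x : 0 <= Z x by rewrite subr_ge0 -expR0 ler_expR fine_ge0.
have mZ : measurable_fun [set: T] Z.
  apply: measurable_funB => //; apply: measurableT_comp => //.
  exact: measurableT_comp.
have -> : (\int[mu]_x tau alpha (`|X x| / (3 * a))%R = \int[mu]_x (Z x)%:E)%E.
  apply: ae_eq_integral => //; first exact/measurable_EFinP.
  have mAy : measurable [set x | A x = +oo%E].
    rewrite -[X in measurable X]setTI; exact: (mA measurableT [set +oo%E]).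
  exists [set x | A x = +oo%E]; split=> //.
  - apply/eqP; rewrite eq_le measure_ge0 andbT leNgt; apply/negP => N0.
    have Nle y : 0 <= y -> (mu [set x | A x = +oo%E] <=
        (2 * expR (- (3 * y)))%:E)%E.
      move=> y0; apply: le_trans (level y y0); apply: le_measure => //.
      + by rewrite inE.
      + rewrite inE -[X in measurable X]setTI.
        exact: emeasurable_fun_o_infty.
      + by move=> x /= ->; exact: ltry.
    pose p := fine (mu [set x | A x = +oo%E]).
    have pE : p%:E = mu [set x | A x = +oo%E].
      by rewrite fineK// fin_num_measure.
    have p0 : 0 < p by rewrite -lte_fin pE.
    (* At the level 1 / p, the bound 2 e^(-3 / p) is smaller than p. *)
    have y0 : 0 <= p^-1 by rewrite invr_ge0 ltW.
    have := Nle _ y0; rewrite -pE lee_fin expRN -[X in X / _]divr1.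
    have pV : p * p^-1 = 1 by rewrite divff// gt_eqF.
    have e3 := expR_ge1Dx (3 * p^-1).
    have e0 : 0 < expR (3 * p^-1) by exact: expR_gt0.
    rewrite divr1 ler_pdivlMr// => pe.
    have : p * (1 + 3 * p^-1) <= p * expR (3 * p^-1) by rewrite ler_wpM2l// ltW.
    lra.
  - move=> x /= H; apply: contra_notP H => Ax _.
    move: (A0 x) Ax; rewrite /tau /Z -/(A x).
    by case: (A x).
pose Zrv : {RV mu >-> R} := HB.pack Z (isMeasurableFun.Build _ _ _ _ Z mZ).
rewrite -[leLHS]/(\int[mu]_x (Zrv x)%:E)%E -expectation_def.
rewrite ge0_expectation_ccdf// -integral_power_tail.
apply: ge0_le_integral => //.
- by apply: measurable_funTS; exact: ccdf_measurable.
- apply/measurable_EFinP; apply: measurable_funM => //.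
  apply: measurableT_comp => //; apply: measurableT_comp => //.
  apply: measurable_funM => //; apply: measurableT_comp => //.
  exact: measurable_funD.
move=> r /=; rewrite in_itv/= andbT => r0.
have r1 : 0 < 1 + r by lra.
have lr0 : 0 <= ln (1 + r) by rewrite ln_ge0//; lra.
apply: le_trans (level _ lr0); rewrite /ccdf /distribution /pushforward.
apply: le_measure; rewrite ?inE.
- by rewrite -[X in measurable X]setTI; apply: (mZ measurableT).
- by rewrite -[X in measurable X]setTI; exact: emeasurable_fun_o_infty.
move=> x /=; rewrite in_itv/= andbT /Z; have := A0 x.
case: (A x) => [e| |]//; last by rewrite ltry.
by move=> _ /= re; rewrite lte_fin -ltr_expR lnK ?posrE//; lra.
Qed.

End LaplaceToLuxemburg.

(** * Lower bounds on the conjugate *)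

Section ConjugateBounds.
Context {R : realType}.
Implicit Types (alpha : R -> \bar R) (s t r y u K c : R).

Lemma mconj_quadratic alpha s0 c s K : assumptionA2 alpha s0 c ->
  0 <= s -> s <= s0 -> (mconj alpha s <= K%:E)%E -> c * s ^+ 2 <= K.
Proof.
case=> _ _ H s_ge0 ss0 HK; rewrite -lee_fin (le_trans _ HK)// H//.
by rewrite s_ge0.
Qed.

Lemma mconj_linear alpha s0 c s K : classC alpha -> assumptionA2 alpha s0 c ->
  s0 <= s -> (mconj alpha s <= K%:E)%E -> c * s0 * s <= K.
Proof.
move=> ha hA2 s0s HK; have [s00 c0 _] := hA2.
have s_gt0 : 0 < s by exact: lt_le_trans s0s.
have := mconj_scale _ _ _ _ ha (ltW s00) s0s s_gt0 HK.
move=> /(mconj_quadratic _ _ _ _ _ hA2 (ltW s00) (lexx _)) H.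
have : s0 * (c * s0) <= s0 * (K / s).
  by rewrite [leRHS]mulrCA mulrC -mulrA -expr2 (le_trans H)// mulrC.
by rewrite ler_pM2l// ler_pdivlMr.
Qed.

(** The inverse is positive because the conjugate is finite somewhere on
    ]0, +oo[, hence small near 0 by convexity; it is finite because the
    conjugate grows at least linearly. The conjugate is lower semicontinuous,
    which gives the bound at the point itself. *)
Lemma minverse_mconjP alpha s0 c : classC alpha -> assumptionA1 alpha ->
  assumptionA2 alpha s0 c ->
  let sigma := fine (minverse (mconj alpha) 2) in
  [/\ 0 < sigma, (mconj alpha sigma <= 2%:E)%E &
    forall s, 0 <= s -> (mconj alpha s <= 2%:E)%E -> s <= sigma].
Proof.
move=> ha [b b0 hb] hA2 sigma; have [s00 c0 _] := hA2.
pose S := [set s%:E | s in [set s : R | 0 <= s /\ (mconj alpha s <= 2%:E)%E]].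
have Sub s : 0 <= s -> (mconj alpha s <= 2%:E)%E ->
    s <= Num.max s0 (2 / (c * s0)).
  move=> s_ge0 s2; rewrite le_max; case: (leP s s0) => //= ss0.
  have := mconj_linear _ _ _ _ _ ha hA2 (ltW ss0) s2.
  by rewrite ler_pdivlMr ?mulr_gt0// mulrC.
have S0 : S 0%E.
  exists 0 => //; split=> //; apply/mconj_le => // t e t0 te.
  have := classC_ge0 _ _ ha t0; rewrite te lee_fin; lra.
have Sfin : ereal_sup S \is a fin_num.
  rewrite fin_numElt; apply/andP; split.
    by rewrite (lt_le_trans _ (ereal_sup_ubound S0))// ltNyr.
  apply: (@le_lt_trans _ _ (Num.max s0 (2 / (c * s0)))%:E); last exact: ltry.
  by apply: ge_ereal_sup => _ [s [s_ge0 s2] <-]; rewrite lee_fin; exact: Sub.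
have sigmaE : sigma%:E = ereal_sup S by rewrite /sigma fineK.
have ub s : 0 <= s -> (mconj alpha s <= 2%:E)%E -> s <= sigma.
  move=> s_ge0 s2; rewrite -lee_fin sigmaE; apply: ereal_sup_ubound.
  by exists s.
split=> //.
- have [s1 s10 s1b] : exists2 s1 : R, 0 < s1 & (s1%:E < b)%E.
    move: b0; case: (b) => [r| |]//; last by exists 1; rewrite ?ltry.
    by rewrite lte_fin => r0; exists (r / 2); rewrite ?lte_fin; lra.
  have : [set s | 0 <= s /\ (mconj alpha s < +oo)%E] s1.
    by rewrite hb; split=> //; exact: ltW.
  move=> [_]; have := mconj_ge0 alpha s1 ha.
  case E : (mconj alpha s1) => [k| |]//; rewrite lee_fin => k0 _.
  (* A factor with l <= 1 and l k <= 2. *)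
  pose l := 2 / (k + 2).
  have l0 : 0 < l by rewrite divr_gt0//; lra.
  have l1 : l <= 1 by rewrite ler_pdivrMr; lra.
  apply: (@lt_le_trans _ _ (l * s1)); first exact: mulr_gt0.
  apply: ub; first by rewrite mulr_ge0// ltW.
  have H : (mconj alpha s1 <= k%:E)%E by rewrite E.
  have := mconj_scale alpha (l * s1) s1 k ha.
  rewrite mulr_ge0 ?(ltW l0) ?(ltW s10)// ler_piMl ?(ltW s10)//.
  move=> /(_ isT isT s10 H) /le_trans; apply.
  rewrite mulfK ?gt_eqF// lee_fin /l mulrAC ler_pdivrMr; lra.
- apply/mconj_le => // t e t0 te.
  have [->|tn0] := eqVneq t 0.
    have := classC_ge0 _ _ ha t0; rewrite te lee_fin; lra.
  have t_gt0 : 0 < t by rewrite lt_neqAle eq_sym tn0.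
  rewrite lerBlDr -ler_pdivlMr// -lee_fin sigmaE.
  apply: ge_ereal_sup => _ [s [s_ge0 s2] <-].
  rewrite lee_fin ler_pdivlMr// -lerBlDr.
  by move/mconj_le : s2; apply.
Qed.

(** The fourth power of 1 + 1/4 is about 2.44. *)
Lemma expR1_ge : 12 / 5 <= expR 1 :> R.
Proof.
have -> : 1 = 4%:R * 4^-1 :> R by rewrite divff.
rewrite expRM_natl.
have : 5 / 4 <= expR 4^-1 :> R by have := expR_ge1Dx (4^-1 : R); lra.
move=> H; apply: (@le_trans _ _ ((5 / 4) ^+ 4)); first lra.
by rewrite lerXn2r// ?nnegrE ?expR_ge0//; lra.
Qed.

Lemma sqrt2_ge : 7 / 5 <= Num.sqrt 2 :> R.
Proof.
have -> : 7 / 5 = Num.sqrt ((7 / 5) ^+ 2) :> R.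
  by rewrite sqrtr_sqr ger0_norm//; lra.
rewrite ler_sqrt; lra.
Qed.

End ConjugateBounds.

(** * Exponential moments from Luxemburg norms *)

Section Exponential.
Context {R : realType}.
Implicit Types x q r : R.

Lemma expR_sub1_le x : expR x - 1 <= x * expR x.
Proof.
have := expR_ge1Dx (- x); have e0 : 0 < expR x by exact: expR_gt0.
rewrite expRN => H.
have : (1 - x) * expR x <= (expR x)^-1 * expR x by rewrite ler_wpM2r// ltW.
rewrite mulVf ?gt_eqF//; lra.
Qed.

(** Twice the inequality e^x - 1 <= x e^x. *)
Lemma expR_le_quadratic x : expR x <= 1 + x + x ^+ 2 * expR `|x|.
Proof.
have H1 := expR_sub1_le x; have H2 := expR_ge1Dx x.
have [x0|x0] := leP 0 x.
  have : x * (expR x - 1) <= x * (x * expR x) by rewrite ler_wpM2l.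
  rewrite ger0_norm//; lra.
have : x * (expR x - 1) <= x * x by rewrite ler_wnM2l// ?(ltW x0)//; lra.
have : x ^+ 2 * 1 <= x ^+ 2 * expR `|x|.
  by rewrite ler_wpM2l ?sqr_ge0// -expR0 ler_expR.
lra.
Qed.

(** The inequality e z <= e^z at z = q x / 2. *)
Lemma sqr_le_expR q x : 0 < q -> 0 <= x ->
  x ^+ 2 <= (2 / (expR 1 * q)) ^+ 2 * expR (q * x).
Proof.
move=> q0 x0.
have e0 : 0 < expR 1 :> R by exact: expR_gt0.
have H : expR 1 * (q * x / 2) <= expR (q * x / 2).
  have -> : expR (q * x / 2) = expR 1 * expR (q * x / 2 - 1).
    by rewrite -expRD; congr expR; lra.
  rewrite ler_pM2l//; have := expR_ge1Dx (q * x / 2 - 1); lra.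
have -> : expR (q * x) = expR (q * x / 2) ^+ 2.
  by rewrite expr2 -expRD; congr expR; lra.
rewrite -exprMn ler_sqr ?nnegrE//; last first.
  by rewrite mulr_ge0 ?expR_ge0// divr_ge0// mulr_ge0 ?ltW.
rewrite mulrAC ler_pdivlMr ?mulr_gt0//; lra.
Qed.

Lemma expR_scaled_le r x : 0 <= r -> r < 1 ->
  expR (r * x) <= 1 + r * x + (2 * r / (expR 1 * (1 - r))) ^+ 2 * expR `|x|.
Proof.
move=> r0 r1; apply: le_trans (expR_le_quadratic _) _; rewrite lerD2l.
have := @sqr_le_expR (1 - r) `|x|; rewrite subr_gt0 => /(_ r1 (normr_ge0 _)) H.
rewrite normrM (ger0_norm r0).
have -> : expR `|x| = expR ((1 - r) * `|x|) * expR (r * `|x|).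
  by rewrite -expRD; congr expR; lra.
rewrite mulrA ler_wpM2r ?expR_ge0//.
have -> : (2 * r / (expR 1 * (1 - r))) ^+ 2 =
    r ^+ 2 * (2 / (expR 1 * (1 - r))) ^+ 2.
  by rewrite -exprMn; congr (_ ^+ 2); ring.
rewrite exprMn -[X in _ * X <= _]real_normK ?num_real// -mulrA.
by rewrite ler_wpM2l ?sqr_ge0.
Qed.

End Exponential.

Section LuxemburgToLaplace.
Context {d : measure_display} {T : measurableType d} {R : realType}.
Implicit Types (mu nu : probability T R) (X W : T -> R).
Implicit Types (alpha : R -> \bar R) (a s t y K B c l u : R).

Lemma young_exp alpha s t K : classC alpha -> 0 <= t ->
  (mconj alpha s <= K%:E)%E ->
  ((expR (s * t))%:E <= (expR K)%:E * (1 + tau alpha t))%E.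
Proof.
move=> ha t0 /(mconj_le _ _ _ ha) H.
have := classC_ge0 _ _ ha t0; rewrite /tau.
case E : (alpha t) => [e| |]//= _.
  rewrite addeC -EFinB -EFinD subrK -EFinM lee_fin -expRD ler_expR.
  by have := H _ _ t0 E; lra.
by rewrite gt0_muley ?lee_fin ?expR_gt0 ?leey// lte_fin expR_gt0.
Qed.

Lemma luxemburg_exp_moment alpha mu W s K : classC alpha ->
  measurable_fun [set: T] W ->
  (\int[mu]_x tau alpha `|W x| <= 1)%E ->
  (mconj alpha s <= K%:E)%E ->
  (\int[mu]_x (expR (s * `|W x|))%:E <= (2 * expR K)%:E)%E.
Proof.
move=> ha mW tauW HK.
have mnW : measurable_fun [set: T] (fun x => `|W x|) by exact: measurableT_comp.
have mtau : measurable_fun [set: T] (fun x => tau alpha `|W x|).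
  by apply: measurable_nondecreasing => // r t; exact: tau_nondecreasing.
apply: (@le_trans _ _
    (\int[mu]_x ((expR K)%:E * (1 + tau alpha `|W x|)))%E).
  apply: ge0_le_integral => //.
  - apply/measurable_EFinP; apply: measurableT_comp => //.
    exact: measurable_funM.
  - by apply: emeasurable_funM => //; exact: emeasurable_funD.
  - by move=> x _; exact: young_exp.
rewrite ge0_integralZl//; last 2 first.
- exact: emeasurable_funD.
- by move=> x _; rewrite adde_ge0// tau_ge0.
rewrite ge0_integralD//; last by move=> x _; exact: tau_ge0.
rewrite integral_cst// [X in (1 * X)%E]probability_setT mule1.
rewrite mulrC EFinM lee_wpmul2l ?lee_fin ?expR_ge0//.
have -> : 2%:E = (1 + 1)%E :> \bar R by rewrite -EFinD.
by rewrite leeD2l.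
Qed.

(** The exponential moment at [sigma] controls the quadratic remainder of
    e^(r sigma W), with a gain r^2. *)
Lemma centered_laplace mu W B sigma r M : measurable_fun [set: T] W ->
  (forall x, `|W x| <= B) -> \int[mu]_x W x = 0 -> 0 <= r -> r < 1 ->
  0 <= sigma ->
  (\int[mu]_x (expR (sigma * `|W x|))%:E <= M%:E)%E ->
  (\int[mu]_x (expR (r * sigma * W x))%:E <=
   (1 + (2 * r / (expR 1 * (1 - r))) ^+ 2 * M)%:E)%E.
Proof.
move=> mW WB W0 r0 r1 sigma0 HM.
set k := (2 * r / (expR 1 * (1 - r))) ^+ 2.
have k0 : 0 <= k by exact: sqr_ge0.
have msW : measurable_fun [set: T] (fun x => r * sigma * W x).
  exact: measurable_funM.
have mE : measurable_fun [set: T] (fun x => expR (sigma * `|W x|)).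
  apply: measurableT_comp => //; apply: measurable_funM => //.
  exact: measurableT_comp.
have iL : mu.-integrable [set: T] (fun x => (1 + r * sigma * W x)%:E).
  apply: (bounded_integrable mu _ (1 + r * sigma * B)).
    exact: measurable_funD.
  move=> x; rewrite (le_trans (ler_normD _ _))// normr1 lerD2l normrM.
  by rewrite ger0_norm ?mulr_ge0// ler_wpM2l ?mulr_ge0.
have iE : mu.-integrable [set: T] (fun x => (k * expR (sigma * `|W x|))%:E).
  apply/integrableP; split.
    by apply/measurable_EFinP; exact: measurable_funM.
  rewrite (eq_integral (fun x => k%:E * (expR (sigma * `|W x|))%:E)%E).
    2: by move=> x _; rewrite gee0_abs;
      [rewrite EFinM|rewrite lee_fin mulr_ge0 ?expR_ge0].
  rewrite ge0_integralZl//; last exact/measurable_EFinP.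
  apply: (@le_lt_trans _ _ (k%:E * M%:E)%E); last exact: ltry.
  by rewrite lee_wpmul2l.
apply: (@le_trans _ _ (\int[mu]_x
    (1 + r * sigma * W x + k * expR (sigma * `|W x|))%:E)%E).
  apply: le_integral_measurable.
  - by apply/measurable_EFinP; exact: measurableT_comp.
  - apply/measurable_EFinP; apply: measurable_funD; last exact: measurable_funM.
    exact: measurable_funD.
  move=> x; rewrite lee_fin -!(mulrA r).
  apply: le_trans (expR_scaled_le _ (sigma * W x) r0 r1) _.
  by rewrite normrM (ger0_norm sigma0).
under eq_integral do rewrite EFinD.
rewrite integralD_EFin//.
have -> : (\int[mu]_x (1 + r * sigma * W x)%:E = 1)%E.
  rewrite (bounded_integralE mu _ (1 + r * sigma * B)); first last.
  - move=> x; rewrite (le_trans (ler_normD _ _))// normr1 lerD2l normrM.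
    by rewrite ger0_norm ?mulr_ge0// ler_wpM2l ?mulr_ge0.
  - exact: measurable_funD.
  have iW := bounded_integrable mu _ _ mW WB.
  rewrite RintegralD//; last 2 first.
  - exact: (bounded_integrable mu (cst 1) `|1|).
  - apply: (bounded_integrable mu _ (r * sigma * B)) => // x.
    by rewrite normrM ger0_norm ?mulr_ge0// ler_wpM2l ?mulr_ge0.
  rewrite RintegralZl// W0 mulr0 addr0 Rintegral_cst//.
  by rewrite [X in fine X]probability_setT mulr1.
rewrite EFinD leeD2l//.
rewrite (eq_integral (fun x => k%:E * (expR (sigma * `|W x|))%:E)%E)//.
rewrite ge0_integralZl//; last exact/measurable_EFinP.
by rewrite [leRHS]EFinM lee_wpmul2l.
Qed.

End LuxemburgToLaplace.

(** * The Laplace bound with the explicit constant *)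

Section Constants.
Context {R : realType}.
Implicit Types (alpha : R -> \bar R) (s t r y u K c x : R).

(** If x1 = sqrt 2 * y / sqrt (c (1 - u)) is at most [s0], the quadratic lower
    bound on the conjugate applies at x1. Otherwise the linear bound beyond
    [s0] does, and the condition u / sqrt (1 - u) <= s0 sqrt c compensates for
    the lost factor. *)
Lemma mconj_small alpha s0 c u y x K : classC alpha ->
  assumptionA2 alpha s0 c -> admissible s0 c u -> 0 <= y -> y <= u ->
  Num.sqrt 2 * (y / Num.sqrt (c * (1 - u))) <= x ->
  (mconj alpha x <= K%:E)%E -> 7 / 5 * y ^+ 2 / (1 - y) <= K.
Proof.
move=> ha hA2 [/andP[u0 u1] hu _] y0 yu x1x HK.
have [s00 c0 _] := hA2.
have u1' : 0 < 1 - u by rewrite subr_gt0.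
have w0 : 0 < c * (1 - u) by rewrite mulr_gt0.
set w := Num.sqrt (c * (1 - u)) in x1x.
have wp : 0 < w by rewrite sqrtr_gt0.
have w2 : w ^+ 2 = c * (1 - u) by rewrite sqr_sqrtr// ltW.
set q : R := Num.sqrt 2 in x1x.
have q2 : q ^+ 2 = 2 by rewrite sqr_sqrtr.
have q1 : 7 / 5 <= q by exact: sqrt2_ge.
set x1 := q * (y / w) in x1x.
have q0 : 0 <= q by lra.
have x10 : 0 <= x1 by rewrite mulr_ge0// divr_ge0// ltW.
have HK1 := mconj_nondecreasing _ _ _ _ ha x10 x1x HK.
have us0 : u / w <= s0.
  move: hu; rewrite ler_pdivrMr ?sqrtr_gt0// -mulrA -sqrtrM ?(ltW c0)//.
  by rewrite -/w -ler_pdivrMr.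
have yu2 : y ^+ 2 / (1 - y) <= y * u / (1 - u).
  rewrite expr2 -!mulrA ler_wpM2l//; apply: ler_pM => //.
    by rewrite invr_ge0; lra.
  by rewrite lef_pV2 ?posrE//; lra.
have yuge0 : 0 <= y * u / (1 - u) by rewrite divr_ge0 ?mulr_ge0// ltW.
have goal_of : q * (y * u / (1 - u)) <= K -> 7 / 5 * y ^+ 2 / (1 - y) <= K.
  apply: le_trans; rewrite -mulrA; apply: ler_pM => //.
  by rewrite divr_ge0 ?sqr_ge0//; lra.
have [x1s0|x1s0] := leP x1 s0.
  have := mconj_quadratic _ _ _ _ _ hA2 x10 x1s0 HK1.
  have -> : c * x1 ^+ 2 = 2 * (y ^+ 2 / (1 - u)).
    rewrite /x1 !exprMn exprVn w2 q2; field; lra.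
  apply: le_trans; rewrite -mulrA.
  have yy : y ^+ 2 / (1 - y) <= y ^+ 2 / (1 - u).
    by rewrite ler_wpM2l ?sqr_ge0// lef_pV2 ?posrE//; lra.
  have yy0 : 0 <= y ^+ 2 / (1 - y) by rewrite divr_ge0 ?sqr_ge0//; lra.
  lra.
apply: goal_of.
have := mconj_linear _ _ _ _ _ ha hA2 (ltW x1s0) HK1; apply: le_trans.
have -> : q * (y * u / (1 - u)) = c * (u / w) * x1.
  have -> : c * (u / w) * x1 = q * (y * u) * c / w ^+ 2.
    rewrite /x1; field; lra.
  rewrite w2; field; lra.
by rewrite ler_wpM2r// ler_wpM2l// ltW.
Qed.

(** This amounts to 8 (1 - y) <= 7/5 (e - y)^2, where e >= 12/5 is enough. *)
Lemma taylor_term_le y : 0 <= y -> y < 1 ->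
  8 * (y / (expR 1 - y)) ^+ 2 <= 7 / 5 * y ^+ 2 / (1 - y).
Proof.
move=> y0 y1; have e := @expR1_ge R.
have ey : 0 < expR 1 - y by lra.
have H : 8 * (1 - y) <= 7 / 5 * (expR 1 - y) ^+ 2.
  have : (12 / 5 - y) ^+ 2 <= (expR 1 - y) ^+ 2.
    by rewrite lerXn2r ?nnegrE//; lra.
  by have := sqr_ge0 y; lra.
rewrite exprMn exprVn mulrCA -[_ * _ / _]mulrA [leRHS]mulrCA.
rewrite ler_wpM2l ?sqr_ge0// ler_pdivrMr ?exprn_gt0// mulrAC.
by rewrite ler_pdivlMr//; lra.
Qed.

End Constants.

Section NormalizedLaplace.
Context {d : measure_display} {T : measurableType d} {R : realType}.
Implicit Types (mu nu : probability T R) (X W : T -> R).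
Implicit Types (alpha : R -> \bar R) (a s t y K B c l u : R).

(** The two regimes y <= u and y > u of y = e s / sigma correspond to the two
    terms of the maximum in the constant. *)
Lemma laplace_normalized alpha s0 c u mu W B : classC alpha ->
  assumptionA1 alpha -> assumptionA2 alpha s0 c -> admissible s0 c u ->
  measurable_fun [set: T] W -> (forall x, `|W x| <= B) ->
  \int[mu]_x W x = 0 -> (\int[mu]_x tau alpha `|W x| <= 1)%E ->
  laplace_bound alpha mu (Num.sqrt 2 * malpha alpha c u) W.
Proof.
move=> ha hA1 hA2 hu mW WB W0 tauW s K s_ge0 HK.
have [s00 c0 _] := hA2; have [/andP[u0 u1] _ _] := hu.
have [sigma0 sigma2 sigma_ub] := minverse_mconjP _ _ _ ha hA1 hA2.
move: HK; rewrite /malpha; set sigma := fine _ in sigma0 sigma2 sigma_ub *.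
set w := Num.sqrt (c * (1 - u)).
have wp : 0 < w by rewrite sqrtr_gt0 mulr_gt0// subr_gt0.
set m := expR 1 * _.
have e0 : 0 < expR 1 :> R by exact: expR_gt0.
have e1 := @expR1_ge R.
have m1 : expR 1 / (sigma * w) <= m.
  by rewrite /m ler_pM2l// div1r le_max lexx.
have m2 : expR 1 / u <= m.
  by rewrite /m ler_pM2l// !div1r le_max lexx orbT.
set q : R := Num.sqrt 2.
have q1 : 7 / 5 <= q by exact: sqrt2_ge.
have q2 : q ^+ 2 = 2 by rewrite sqr_sqrtr.
move=> HK; pose y := expR 1 * s / sigma.
have y0 : 0 <= y by rewrite divr_ge0 ?mulr_ge0// ltW.
have mE : measurable_fun [set: T] (fun x => expR (s * W x)).
  by apply: measurableT_comp => //; exact: measurable_funM.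
have [yu|uy] := leP y u.
  have y1 : y < 1 by exact: le_lt_trans yu u1.
  pose r := s / sigma.
  have ry : r = y / expR 1 by rewrite /r /y; field; lra.
  have r0 : 0 <= r by rewrite divr_ge0// ltW.
  have r1 : r < 1 by rewrite ry ltr_pdivrMr//; lra.
  have mom := luxemburg_exp_moment _ _ _ _ _ ha mW tauW sigma2.
  have := centered_laplace _ _ _ _ _ _ mW WB W0 r0 r1 (ltW sigma0) mom.
  rewrite {1}/r divfK ?gt_eqF// => /le_trans; apply; rewrite lee_fin.
  apply: (@le_trans _ _ (1 + K)); last exact: expR_ge1Dx.
  rewrite lerD2l.
  apply: (@le_trans _ _ (7 / 5 * y ^+ 2 / (1 - y))).
    apply: le_trans (taylor_term_le _ y0 y1).
    have -> : expR 2 = expR 1 ^+ 2 :> R by rewrite -expRM_natl mulr1.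
    rewrite ry; set E := expR 1 in e1 *.
    have -> // : (2 * (y / E) / (E * (1 - y / E))) ^+ 2 * (2 * E ^+ 2) =
      8 * (y / (E - y)) ^+ 2.
    field; apply/andP; split; lra.
  apply: mconj_small ha hA2 hu y0 yu _ HK.
  rewrite -/q -/w -[leRHS]mulrA ler_wpM2l ?sqrtr_ge0//.
  have -> : y / w = expR 1 / (sigma * w) * s by rewrite /y; field; lra.
  by rewrite ler_wpM2r.
have s_gt0 : 0 < s.
  rewrite lt_neqAle s_ge0 andbT eq_sym; apply/eqP => s0'.
  by move: uy; rewrite /y s0' mulr0 mul0r ltNge (ltW u0).
have m0 : 0 < m by apply: lt_le_trans m2; rewrite divr_gt0.
have ms : sigma < m * s.
  apply: (@lt_le_trans _ _ (expR 1 / u * s)); last by rewrite ler_wpM2r.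
  by rewrite mulrAC ltr_pdivlMr// mulrC -ltr_pdivlMr.
have q0 : 0 < q by lra.
have t0 : 0 < q * m * s by rewrite mulr_gt0 ?(mulr_gt0 q0).
have K0 := mconj_le_ge0 _ _ _ ha HK.
(* q m s exceeds [sigma], beyond which the conjugate is larger than 2. *)
have K2 : 2 <= K.
  rewrite leNgt; apply/negP => K2.
  have : m * s <= sigma.
    apply: sigma_ub; first by rewrite mulr_ge0// ltW.
    have ms0 : 0 <= m * s by rewrite mulr_ge0// ltW.
    have mst : m * s <= q * m * s by rewrite -(mulrA q) ler_peMl//; lra.
    apply: le_trans (mconj_nondecreasing _ _ _ _ ha ms0 mst HK) _.
    by rewrite lee_fin ltW.
  by rewrite leNgt ms.
have em : 2 <= q * m.
  have : expR 1 <= m.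
    by apply: le_trans m2; rewrite ler_pdivlMr// ler_piMr// ltW.
  move=> em; have : (7 / 5) * (12 / 5) <= q * m by apply: ler_pM => //; lra.
  lra.
(* Dilating s by q m >= 2 at least doubles the conjugate. *)
have HKs : (mconj alpha s <= (K / 2)%:E)%E.
  have st : s <= q * m * s by rewrite ler_peMl//; lra.
  apply: le_trans (mconj_scale _ _ _ _ ha s_ge0 st t0 HK) _.
  rewrite lee_fin mulrC ler_wpM2l// ler_pdivrMr// mulrA ler_peMl//; lra.
have mom := luxemburg_exp_moment _ _ _ _ _ ha mW tauW HKs.
apply: (@le_trans _ _ (\int[mu]_x (expR (s * `|W x|))%:E)%E).
  apply: ge0_le_integral => //.
  - exact/measurable_EFinP.
  - apply/measurable_EFinP; apply: measurableT_comp => //.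
    by apply: measurable_funM => //; exact: measurableT_comp.
  - by move=> x _; rewrite lee_fin ler_expR ler_wpM2l// ler_norm.
apply: le_trans mom _; rewrite lee_fin.
have -> : expR K = expR (K / 2) * expR (K / 2).
  by rewrite -expRD; congr expR; lra.
rewrite ler_wpM2r ?expR_ge0//; have := expR_ge1Dx (K / 2); lra.
Qed.

End NormalizedLaplace.

(** * Assembling the equivalence *)

Section LuxemburgToTransport.
Context {d : measure_display} {T : measurableType d} {R : realType}.
Implicit Types (mu nu : probability T R) (X : T -> R) (Phi : set (T -> R)).
Implicit Types (alpha : R -> \bar R) (a s t y K B M c l u : R).

Lemma laplace_bound_nondecreasing alpha mu a a' X : classC alpha ->
  0 <= a -> a <= a' ->
  laplace_bound alpha mu a X -> laplace_bound alpha mu a' X.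
Proof.
move=> ha a0 aa' lap s K s0 HK; apply: lap => //.
by apply: mconj_nondecreasing HK => //; rewrite ?mulr_ge0// ler_wpM2r.
Qed.

Lemma malpha_gt0 alpha c u : 0 < u -> 0 < malpha alpha c u.
Proof.
move=> u0; rewrite mulr_gt0 ?expR_gt0// lt_max; apply/orP; right.
by rewrite divr_gt0.
Qed.

Lemma luxemburg_laplace alpha s0 c u mu l (phi : T -> R) B : classC alpha ->
  assumptionA1 alpha -> assumptionA2 alpha s0 c -> admissible s0 c u ->
  measurable_fun [set: T] phi -> (forall x, `|phi x| <= B) -> 0 < l ->
  (\int[mu]_x tau alpha (`|phi x - \int[mu]_z phi z| / l)%R <= 1)%E ->
  laplace_bound alpha mu (Num.sqrt 2 * malpha alpha c u * l)
    (fun x => phi x - \int[mu]_z phi z).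
Proof.
move=> ha hA1 hA2 hu mphi phiB l0 tauX s K s_ge0.
pose X x := phi x - \int[mu]_z phi z; set m := malpha _ _ _.
have XE x : l^-1 * X x = X x / l by rewrite mulrC.
have mW := measurable_affine phi l^-1 (\int[mu]_z phi z) mphi.
have WB := bounded_affine phi B l^-1 (\int[mu]_z phi z) phiB.
have W0 := Rintegral_affine mu phi B l^-1 (\int[mu]_z phi z) mphi phiB.
rewrite subrr mulr0 in W0.
have tauW : (\int[mu]_x tau alpha `|(l^-1 * X x)%R|%R <= 1)%E.
  rewrite (eq_integral (fun x => tau alpha (`|X x| / l)%R))// => x _.
  by rewrite XE normrM normfV (ger0_norm (ltW l0)).
have lap := laplace_normalized _ _ _ _ _ _ _ ha hA1 hA2 hu mW WB W0 tauW.
rewrite -(mulrA _ l s) => HK; have ls0 : 0 <= l * s by rewrite mulr_ge0// ltW.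
have := lap _ _ ls0 HK.
by under eq_integral do rewrite mulrACA divff ?gt_eqF// mul1r.
Qed.

(** Every constant larger than the claimed one is of the form k l with l above
    the Luxemburg norms of all the functions, which is what
    [laplace_transport] asks for. *)
Lemma luxemburg_transport alpha s0 c u mu Phi M : classC alpha ->
  assumptionA1 alpha -> assumptionA2 alpha s0 c -> admissible s0 c u ->
  (forall phi, Phi phi -> measurable_fun [set: T] phi) ->
  (forall phi, Phi phi -> exists B, forall x, `|phi x| <= B) ->
  (forall phi, Phi phi -> Phi (fun x => - phi x)) ->
  0 < M -> luxemburg_bound alpha Phi mu M ->
  transport_inequality alpha Phi mu (Num.sqrt 2 * malpha alpha c u * M).
Proof.
move=> ha hA1 hA2 hu mPhi PhiB PhiN M0 lux.
have [/andP[u0 _] _ _] := hu.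
have k0 : 0 < Num.sqrt 2 * malpha alpha c u.
  by rewrite mulr_gt0 ?malpha_gt0// sqrtr_gt0.
apply: laplace_transport => //; first by rewrite mulr_gt0.
move=> phi a' Pphi Ma'; have [B phiB] := PhiB _ Pphi.
have : (luxemburg mu alpha (fun x => phi x - \int[mu]_z phi z)%R <
    (a' / (Num.sqrt 2 * malpha alpha c u))%:E)%E.
  apply: le_lt_trans (lux _ Pphi) _; rewrite lte_fin ltr_pdivlMr//.
  by rewrite mulrC.
move=> /ereal_inf_lt [_ [l [l0 taul] <-]]; rewrite lte_fin ltr_pdivlMr// => la'.
pose k := Num.sqrt 2 * malpha alpha c u.
apply: (@laplace_bound_nondecreasing _ _ (k * l)) => //.
- by rewrite mulr_ge0// ltW.
- by rewrite mulrC ltW.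
exact: (luxemburg_laplace _ s0 _ _ _ _ _ B ha hA1 hA2 hu (mPhi _ Pphi)).
Qed.

Lemma transport_luxemburg alpha mu Phi a : classC alpha ->
  (forall phi, Phi phi -> measurable_fun [set: T] phi) ->
  (forall phi, Phi phi -> exists B, forall x, `|phi x| <= B) ->
  (forall phi, Phi phi -> Phi (fun x => - phi x)) ->
  0 < a -> transport_inequality alpha Phi mu a ->
  luxemburg_bound alpha Phi mu (3 * a).
Proof.
move=> ha mPhi PhiB PhiN a0 transp phi Pphi; have [B phiB] := PhiB _ Pphi.
have lap := transport_laplace _ _ _ _ _ _ ha a0 transp Pphi (mPhi _ Pphi) phiB.
have NphiB x : `|- phi x| <= B by rewrite normrN.
have PN := PhiN _ Pphi.
have lapN := transport_laplace _ _ _ _ _ _ ha a0 transp PN (mPhi _ PN) NphiB.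
apply: laplace_luxemburg => //; first exact: measurable_funB (mPhi _ Pphi) _.
move: lapN; rewrite (Rintegral_opp _ _ B (mPhi _ Pphi) phiB).
congr laplace_bound.
by apply/funext => x; rewrite opprB opprK addrC.
Qed.

End LuxemburgToTransport.

Lemma admissible_exists {R : realType} (s0 c : R) : 0 < s0 -> 0 < c ->
  exists u, admissible s0 c u.
Proof.
move=> s00 c0; have k0 : 0 < s0 * Num.sqrt c by rewrite mulr_gt0// sqrtr_gt0.
set k := s0 * _ in k0; pose u := Num.min 2^-1 (k / 2).
have u0 : 0 < u by rewrite lt_min divr_gt0// andbT; lra.
have u2 : u <= 2^-1 by rewrite ge_min lexx.
have uk : u <= k / 2 by rewrite ge_min lexx orbT.
exists u; split; first by lra.
- have h : 2^-1 <= Num.sqrt (1 - u).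
    have -> : 2^-1 = Num.sqrt (2^-1 ^+ 2) :> R.
      by rewrite sqrtr_sqr ger0_norm//; lra.
    by rewrite ler_sqrt; lra.
  rewrite -/k ler_pdivrMr; last lra.
  have : k * 2^-1 <= k * Num.sqrt (1 - u) by rewrite ler_wpM2l// ltW.
  lra.
- rewrite ler_pdivrMr; last lra.
  have : u ^+ 3 <= 1 by rewrite exprn_ile1//; lra.
  lra.
Qed.

Theorem theorem1p7 (R : realType) (X : completeMetricType R)
    (hX : separable X)
    (Phi : set (borel X -> R))
    (Phi_meas : forall phi, Phi phi -> measurable_fun [set: borel X] phi)
    (Phi_bounded : forall phi, Phi phi -> exists B : R, forall x, `|phi x| <= B)
    (Phi_sym : forall phi, Phi phi -> Phi (fun x => - phi x))
    (alpha : R -> \bar R) (halpha : classC alpha)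
    (hA1 : assumptionA1 alpha)
    (s0 c : R) (hA2 : assumptionA2 alpha s0 c)
    (mu : probability (borel X) R) :
  [/\ (exists2 a : R, 0 < a & transport_inequality alpha Phi mu a) <->
      (exists2 M : R, 0 < M & luxemburg_bound alpha Phi mu M),
      forall a : R, 0 < a -> transport_inequality alpha Phi mu a ->
        luxemburg_bound alpha Phi mu (3 * a)
    & forall (u M : R), admissible s0 c u -> 0 < M ->
        luxemburg_bound alpha Phi mu M ->
        transport_inequality alpha Phi mu (Num.sqrt 2 * malpha alpha c u * M)].
Proof.
have forward a : 0 < a -> transport_inequality alpha Phi mu a ->
    luxemburg_bound alpha Phi mu (3 * a).
  exact: transport_luxemburg.
have backward u M : admissible s0 c u -> 0 < M ->
    luxemburg_bound alpha Phi mu M ->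
    transport_inequality alpha Phi mu (Num.sqrt 2 * malpha alpha c u * M).
  by move=> hu; exact: (luxemburg_transport alpha s0).
split=> //; split=> [[a a0 transp]|[M M0 lux]].
  by exists (3 * a); [rewrite mulr_gt0|exact: forward].
have [s00 c0 _] := hA2; have [u hu] := admissible_exists _ _ s00 c0.
exists (Num.sqrt 2 * malpha alpha c u * M); last exact: backward.
have [/andP[u0 _] _ _] := hu.
by rewrite mulr_gt0// mulr_gt0 ?malpha_gt0// sqrtr_gt0.
Qed.
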